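(* The zeroness problem for polynomial recursive sequences over $\mathbb{Q}$ is PSPACE-hard.
   Context: A sequence $u^{(1)}=\langle u^{(1)}_n\rangle_{n\in\mathbb{N}}$ over a field $\mathbb{F}$ is polynomially recursive (polyrec) of dimension $k$ if there are auxiliary sequences $u^{(2)},\ldots,u^{(k)}$ over $\mathbb{F}$ and polynomials $P_1,\ldots,P_k\in\mathbb{F}[x_1,\ldots,x_k]$ such that $u^{(i)}_{n+1}=P_i(u^{(1)}_n,\ldots,u^{(k)}_n)$ for all $i\in\{1,\ldots,k\}$ and all $n\in\mathbb{N}$. Such a sequence is given on input by the initial values $u^{(1)}_0,\ldots,u^{(k)}_0\in\mathbb{F}$ together with arithmetic circuits representing $P_1,\ldots,P_k$. An arithmetic circuit uses binary addition and multiplication gates, nullary input gates bijectively labelled with the variables, and nullary constant gates each labelled with an element of $\mathbb{F}$, and has designated output gates. The zeroness problem: given a polyrec sequence $u=u^{(1)}$ in this encoding, decide whether $u_n=0$ for all $n\in\mathbb{N}$. *)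

(* Defs.v *)
From Stdlib Require Import PArith.
From mathcomp Require Import all_boot all_order all_algebra.
From mathcomp.multinomials Require Import mpoly.

Set Implicit Arguments.
Unset Strict Implicit.
Unset Printing Implicit Defensive.

Import GRing.Theory.
Local Open Scope ring_scope.

Inductive move := MoveL | MoveN | MoveR.

(* A one-way infinite tape.  Cell 0 is the left end; [left_part] lists the
   cells strictly left of the head, nearest first; every cell beyond
   [right_part] is blank.  Listed cells include all the visited ones. *)
Record tape (G : Type) :=
  Tape { left_part : seq G; scanned : G; right_part : seq G }.

Definition tape_size (G : Type) (t : tape G) : nat :=
  (size (left_part t) + (size (right_part t)).+1)%N.

Definition tape_cells (G : Type) (t : tape G) : seq G :=
  rev (left_part t) ++ scanned t :: right_part t.

Definition load_tape (G : Type) (blank : G) (s : seq G) : tape G :=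
  Tape [::] (head blank s) (behead s).

(* Moving left on cell 0 leaves the head in place. *)
Definition tape_act (G : Type) (blank : G) (t : tape G) (a : G * move) :
    tape G :=
  let: Tape l _ r := t in
  match a.2 with
  | MoveN => Tape l a.1 r
  | MoveR => Tape (a.1 :: l) (head blank r) (behead r)
  | MoveL => if l is x :: l' then Tape l' x (a.1 :: r) else Tape l a.1 r
  end.

(* Deterministic Turing machines with [(ntapes M).+1] tapes over the input
   alphabet [bool], embedded by [tm_bit] into the tape alphabet. *)
Record TM := MkTM {
  ntapes : nat;
  tm_state : finType;
  tm_sym : finType;
  tm_blank : tm_sym;
  tm_bit : bool -> tm_sym;
  tm_start : tm_state;
  tm_accept : tm_state;
  tm_reject : tm_state;
  tm_trans : tm_state -> {ffun 'I_ntapes.+1 -> tm_sym} ->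
             tm_state * {ffun 'I_ntapes.+1 -> tm_sym * move};
  tm_bit_inj : injective tm_bit;
  tm_bit_blank : forall b, tm_bit b != tm_blank;
  tm_accept_reject : tm_accept != tm_reject
}.

Record config (M : TM) := Config {
  cfg_state : tm_state M;
  cfg_tapes : {ffun 'I_(ntapes M).+1 -> tape (tm_sym M)}
}.

Definition halted (M : TM) (c : config M) : bool :=
  (cfg_state c == tm_accept M) || (cfg_state c == tm_reject M).

Definition tm_step (M : TM) (c : config M) : config M :=
  if halted c then c else
  let: (q, act) :=
    tm_trans (cfg_state c) [ffun i => scanned (cfg_tapes c i)] in
  Config q [ffun i => tape_act (tm_blank M) (cfg_tapes c i) (act i)].

Definition tm_init (M : TM) (w : seq bool) : config M :=
  Config (tm_start M)
    [ffun i => load_tape (tm_blank M)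
                 (if i == ord0 then map (@tm_bit M) w else [::])].

Definition tm_run (M : TM) (w : seq bool) (t : nat) : config M :=
  iter t (@tm_step M) (tm_init M w).

Definition cfg_space (M : TM) (c : config M) : nat :=
  (\sum_(i < (ntapes M).+1) tape_size (cfg_tapes c i))%N.

(* The output is read on the last tape, up to trailing blanks. *)
Definition cfg_output (M : TM) (c : config M) (v : seq bool) : Prop :=
  exists m : nat,
    tape_cells (cfg_tapes c ord_max) =
      map (@tm_bit M) v ++ nseq m (tm_blank M).

Definition poly_bounded (s : nat -> nat) : Prop :=
  exists c d : nat, forall n : nat, (s n <= c * n ^ d + c)%N.

Definition language := seq bool -> Prop.

Definition decides (M : TM) (L : language) : Prop :=
  forall w : seq bool, exists t : nat,
    halted (tm_run M w t) /\
    (cfg_state (tm_run M w t) == tm_accept M <-> L w).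

Definition runs_in_space (M : TM) (s : nat -> nat) : Prop :=
  forall (w : seq bool) (t : nat), (cfg_space (tm_run M w t) <= s (size w))%N.

Definition PSPACE (L : language) : Prop :=
  exists (M : TM) (s : nat -> nat),
    poly_bounded s /\ decides M L /\ runs_in_space M s.

Definition computes_in_time (M : TM) (f : seq bool -> seq bool)
    (T : nat -> nat) : Prop :=
  forall w : seq bool, exists t : nat,
    (t <= T (size w))%N /\ halted (tm_run M w t) /\
    cfg_output (tm_run M w t) (f w).

Definition poly_time_computable (f : seq bool -> seq bool) : Prop :=
  exists (M : TM) (T : nat -> nat), poly_bounded T /\ computes_in_time M f T.

Definition reduces_to (L1 L2 : language) : Prop :=
  exists f : seq bool -> seq bool,
    poly_time_computable f /\ forall w, L1 w <-> L2 (f w).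

Definition PSPACE_hard (L : language) : Prop :=
  forall L' : language, PSPACE L' -> reduces_to L' L.

Inductive gate (F : Type) (k : nat) :=
  | Input of 'I_k
  | Const of F
  | Add of nat & nat
  | Mul of nat & nat.

Definition operands (F : Type) (k : nat) (g : gate F k) : seq nat :=
  match g with Add i j | Mul i j => [:: i; j] | _ => [::] end.

Definition is_input (F : Type) (k : nat) (i : 'I_k) (g : gate F k) : bool :=
  if g is Input j then j == i else false.

(* Acyclicity: gates are listed in a topological order, the head of [gs] being
   gate number [n]. *)
Fixpoint acyclic_from (F : Type) (k n : nat) (gs : seq (gate F k)) : bool :=
  if gs is g :: gs' then
    all (fun i => (i < n)%N) (operands g) && acyclic_from n.+1 gs'
  else true.

Definition wf_circuit (F : Type) (k : nat) (gs : seq (gate F k))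
    (outs : seq nat) : bool :=
  [&& acyclic_from 0 gs,
      [forall i : 'I_k, count (is_input i) gs == 1%N]
    & all (fun o => (o < size gs)%N) outs].

(* Circuits with [k] variables and [m] designated output gates. *)
Record circuit (F : Type) (k m : nat) := Circuit {
  gates : seq (gate F k);
  outputs : m.-tuple nat;
  circuit_wf : wf_circuit gates outputs
}.

Definition gate_poly (F : comNzRingType) (k : nat) (vs : seq {mpoly F[k]})
    (g : gate F k) : {mpoly F[k]} :=
  match g with
  | Input i => 'X_i
  | Const c => c%:MP
  | Add i j => vs`_i + vs`_j
  | Mul i j => vs`_i * vs`_j
  end.

Definition gate_polys (F : comNzRingType) (k : nat) (gs : seq (gate F k)) :
    seq {mpoly F[k]} :=
  foldl (fun vs g => rcons vs (gate_poly vs g)) [::] gs.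

Definition circuit_poly (F : comNzRingType) (k m : nat) (C : circuit F k m)
    (i : 'I_m) : {mpoly F[k]} :=
  (gate_polys (gates C))`_(tnth (outputs C) i).

(* The sequences u^(1), ..., u^(k) are indexed by 'I_k, from 0. *)
Fixpoint polyrec_state (F : comNzRingType) (k : nat)
    (P : 'I_k -> {mpoly F[k]}) (u0 : 'I_k -> F) (n : nat) : 'I_k -> F :=
  if n is n'.+1 then fun i => (P i).@[polyrec_state P u0 n'] else u0.

(* An input of dimension [pr_dim.+1]; dimension 0 is excluded since u^(1) must
   exist. *)
Record polyrec_input (F : Type) := PolyrecInput {
  pr_dim : nat;
  pr_init : pr_dim.+1.-tuple F;
  pr_circuit : circuit F pr_dim.+1 pr_dim.+1
}.

Definition polyrec_seq (F : comNzRingType) (I : polyrec_input F) (n : nat) :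
    F :=
  polyrec_state (circuit_poly (pr_circuit I)) (tnth (pr_init I)) n ord0.

Definition is_zero_seq (F : comNzRingType) (I : polyrec_input F) : Prop :=
  forall n : nat, polyrec_seq I n = 0.

(* All the codes below are self-delimiting.  Numerators and denominators are
   written in binary.  Gate numbers and variable indices are smaller than the
   number of gates (or variables) listed, so that writing them in unary changes
   the size of an input at most polynomially. *)

Fixpoint enc_pos (p : positive) : seq bool :=
  match p with
  | xH => [:: false]
  | xO p' => true :: false :: enc_pos p'
  | xI p' => true :: true :: enc_pos p'
  end.

(* [n] is written as the binary expansion of the positive number [n + 1]. *)
Definition enc_nat (n : nat) : seq bool := enc_pos (Pos.of_succ_nat n).

Definition enc_int (z : int) : seq bool :=
  match z with
  | Posz n => false :: enc_nat n
  | Negz n => true :: enc_nat n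
  end.

Definition enc_rat (q : rat) : seq bool :=
  enc_int (numq q) ++ enc_nat `|denq q|%N.

Definition enc_unary (n : nat) : seq bool := nseq n true ++ [:: false].

Definition enc_gate (k : nat) (g : gate rat k) : seq bool :=
  match g with
  | Input i => [:: false; false] ++ enc_unary i
  | Const c => [:: false; true] ++ enc_rat c
  | Add i j => [:: true; false] ++ enc_unary i ++ enc_unary j
  | Mul i j => [:: true; true] ++ enc_unary i ++ enc_unary j
  end.

Definition enc_seq (T : Type) (enc : T -> seq bool) (s : seq T) : seq bool :=
  flatten [seq true :: enc x | x <- s] ++ [:: false].

Definition enc_input (I : polyrec_input rat) : seq bool :=
  enc_seq enc_rat (pr_init I) ++
  enc_seq (@enc_gate (pr_dim I).+1) (gates (pr_circuit I)) ++
  enc_seq enc_unary (outputs (pr_circuit I)).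

Definition prefix_code (T : Type) (enc : T -> seq bool) : Prop :=
  forall x y s t, enc x ++ s = enc y ++ t -> x = y /\ s = t.

Lemma enc_pos_prefix : prefix_code enc_pos.
Proof.
elim=> [p IHp|p IHp|] [q|q|] s t //=; last by case.
- by case=> /IHp[-> ->].
- by case=> /IHp[-> ->].
Qed.

Lemma enc_nat_prefix : prefix_code enc_nat.
Proof. by move=> m n s t /enc_pos_prefix[/SuccNat2Pos.inj -> ->]. Qed.

Lemma enc_int_prefix : prefix_code enc_int.
Proof. by move=> [m|m] [n|n] s t //= [] /enc_nat_prefix[-> ->]. Qed.

Lemma enc_rat_prefix : prefix_code enc_rat.
Proof.
move=> x y s t; rewrite /enc_rat -!catA.
case/enc_int_prefix=> eq_num /enc_nat_prefix[eq_den ->]; split=> //.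
have {}eq_den : denq x = denq y by rewrite -[LHS]absz_denq eq_den absz_denq.
by rewrite -[x]divq_num_den -[y]divq_num_den eq_num eq_den.
Qed.

Lemma enc_unary_prefix : prefix_code enc_unary.
Proof.
by elim=> [|m IHm] [|n] s t //= => [[->]|[]/IHm[-> ->]].
Qed.

Lemma enc_gate_prefix (k : nat) : prefix_code (@enc_gate k).
Proof.
move=> [i|c|i j|i j] [i'|c'|i' j'|i' j'] s t //= [].
- by case/enc_unary_prefix=> /val_inj-> ->.
- by case/enc_rat_prefix=> -> ->.
- rewrite -2!(catA (enc_unary _)).
  by case/enc_unary_prefix=> -> /enc_unary_prefix[-> ->].
- rewrite -2!(catA (enc_unary _)).
  by case/enc_unary_prefix=> -> /enc_unary_prefix[-> ->].
Qed.

Lemma enc_seq_prefix (T : Type) (enc : T -> seq bool) :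
  prefix_code enc -> prefix_code (enc_seq enc).
Proof.
move=> encP; elim=> [|x s IHs] [|y t] u v //= => [[->] //|[]].
rewrite /enc_seq /= -!catA => /encP[-> Est].
by have [|-> ->] := IHs t u v; rewrite ?/enc_seq -?catA.
Qed.

Lemma enc_input_inj : injective enc_input.
Proof.
case=> [k u [gs os wf]] [k' u' [gs' os' wf']]; rewrite /enc_input /=.
case/(enc_seq_prefix enc_rat_prefix) => eq_u.
have [eq_k] : k.+1 = k'.+1 by rewrite -(size_tuple u) eq_u size_tuple.
case: k' / eq_k u' eq_u gs' os' wf' => u' /val_inj<- gs' os' wf'.
case/(enc_seq_prefix (@enc_gate_prefix _)) => eq_gs eq_os.
case: gs' / eq_gs wf' => wf'.
have eq_o : os = os'.
  apply: val_inj; move: eq_os.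
  by rewrite -[LHS]cats0 -[RHS]cats0 => /(enc_seq_prefix enc_unary_prefix)[].
by case: os' / eq_o {eq_os} wf' => wf'; rewrite (bool_irrelevance wf wf').
Qed.

Definition zeroness_problem : language :=
  fun w => exists I : polyrec_input rat, w = enc_input I /\ is_zero_seq I.

Lemma zeroness_problem_enc (I : polyrec_input rat) :
  zeroness_problem (enc_input I) <-> is_zero_seq I.
Proof. by split=> [[J [/enc_input_inj <-]]|]; last by exists I. Qed.

(* Main.v *)
From HB Require Import structures.
From mathcomp Require Import all_boot all_order all_algebra.
From mathcomp.multinomials Require Import mpoly.
From mathcomp Require Import zify.
Require Import Defs.

(* Let M decide L in space bounded by a polynomial k(n).  A queue of more than
   k(n) cells, each recording one position of all the tapes of M, together with
   a finite control that pops the front cell, peeks at the next one and pushes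
   an updated cell at the back, simulates one step of M per rotation of the
   queue.  Coding the control and each cell by one rational number, a step of
   this queue automaton is a polynomial map: all the variables are shifted
   except for a bounded number of them, which are updated by Lagrange
   interpolation polynomials that depend only on M.  The first variable is the
   indicator of the rejecting state, so the sequence vanishes exactly when M
   never rejects.  The encoding of the instance consists of constant words, one
   word per input bit, k(n) copies of a constant word, and two lists of words
   ending with 0, 1, 2, ... in unary; a Turing machine whose tapes serve as
   counters writes it in polynomial time. *)

Set Implicit Arguments.
Unset Strict Implicit.
Unset Printing Implicit Defensive.

(** * Counter machines as Turing machines *)

Lemma iota_rcons m n : iota m n.+1 = rcons (iota m n) (m + n).
Proof. by rewrite -addn1 iotaD cats1. Qed.

Definition gsym : finType := option (option bool).
Definition gbit (b : bool) : gsym := Some (Some b).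
Definition gmark : gsym := Some None.

Section Machines.
Variable nt : nat.
Hypothesis nt_gt0 : 0 < nt.

Local Notation tapes := {ffun 'I_nt.+1 -> tape gsym}.
Local Notation heads := {ffun 'I_nt.+1 -> gsym}.
Local Notation acts := {ffun 'I_nt.+1 -> gsym * move}.

(** One entry and one exit: the successor [None] leaves the machine once the action is done, so
    machines compose like structured programs. *)
Record machine := Machine {
  mstate : finType;
  mentry : mstate;
  mtrans : mstate -> heads -> option mstate * acts }.

Definition heads_of (T : tapes) : heads := [ffun i => scanned (T i)].
Definition act_on (T : tapes) (a : acts) : tapes :=
  [ffun i => tape_act None (T i) (a i)].

Inductive reaches (m : machine) : mstate m -> tapes -> nat -> tapes -> Prop :=
| ReachExit s T a :
    mtrans s (heads_of T) = (None, a) -> reaches s T 1 (act_on T a)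
| ReachStep s s' T a n T' :
    mtrans s (heads_of T) = (Some s', a) -> reaches s' (act_on T a) n T' ->
    reaches s T n.+1 T'.

Definition prim (a : heads -> acts) : machine :=
  @Machine unit tt (fun _ h => (None, a h)).

Definition seqm (m1 m2 : machine) : machine :=
  @Machine (mstate m1 + mstate m2)%type (inl (mentry m1))
    (fun s h => match s with
     | inl s1 => let: (o, a) := mtrans s1 h in
                 (Some (if o is Some s' then inl s' else inr (mentry m2)), a)
     | inr s2 => let: (o, a) := mtrans s2 h in (omap inr o, a)
     end).

Definition stay (h : heads) : acts := [ffun i => (h i, MoveN)].

(** The state [None] is the test, so the exit [None] of the body leads back to it. Each test costs
    one step and leaves the tapes alone. *)
Definition whilem (b : pred heads) (m : machine) : machine :=
  @Machine (option (mstate m)) None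
    (fun s h => if s is Some s' then let: (o, a) := mtrans s' h in (Some o, a)
                else (if b h then Some (Some (mentry m)) else None, stay h)).

Definition ifm (b : pred heads) (m1 m2 : machine) : machine :=
  @Machine (option (mstate m1 + mstate m2)) None
    (fun s h => match s with
     | None => (Some (Some (if b h then inl (mentry m1) else inr (mentry m2))),
                stay h)
     | Some (inl s1) => let: (o, a) := mtrans s1 h in (omap (Some \o inl) o, a)
     | Some (inr s2) => let: (o, a) := mtrans s2 h in (omap (Some \o inr) o, a)
     end).

Lemma act_stay (T : tapes) : act_on T (stay (heads_of T)) = T.
Proof. by apply/ffunP=> i; rewrite !ffunE; case: (T i). Qed.

Lemma reaches_seq m1 m2 T n1 T1 n2 T2 :
  reaches (mentry m1) T n1 T1 -> reaches (mentry m2) T1 n2 T2 ->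
  reaches (mentry (seqm m1 m2)) T (n1 + n2) T2.
Proof.
set m := seqm m1 m2 => r1 r2.
have {}r2 : @reaches m (inr (mentry m2)) T1 n2 T2.
  elim: r2 => {T T1 n2 T2 r1} [s T a e|s s' T a n T' e _ IH].
    by apply: (@ReachExit m); rewrite /m /= e.
  by apply: (@ReachStep m _ (inr s')) IH; rewrite /m /= e.
change (@reaches m (inl (mentry m1)) T (n1 + n2) T2).
elim: r1 r2 => {T T1 n1} [s T a e|s s' T a n T' e _ IH] r2.
  by apply: (@ReachStep m _ (inr (mentry m2))) r2; rewrite /m /= e.
by apply: (@ReachStep m _ (inl s')) (IH r2); rewrite /m /= e.
Qed.

Lemma reaches_if (b : pred heads) m1 m2 T n T' :
  reaches (mentry (if b (heads_of T) then m1 else m2)) T n T' ->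
  reaches (mentry (ifm b m1 m2)) T n.+1 T'.
Proof.
set m := ifm b m1 m2 => r.
apply: (@ReachStep m None _ T (stay (heads_of T)) _ _ erefl).
rewrite act_stay; case: (b _) r => r.
  elim: r => {T n T'} [s T a e|s s' T a n T' e _ IH].
    by apply: (@ReachExit m); rewrite /m /= e.
  by apply: (@ReachStep m _ (Some (inl s'))) IH; rewrite /m /= e.
elim: r => {T n T'} [s T a e|s s' T a n T' e _ IH].
  by apply: (@ReachExit m); rewrite /m /= e.
by apply: (@ReachStep m _ (Some (inr s'))) IH; rewrite /m /= e.
Qed.

Lemma reaches_while0 (b : pred heads) m T :
  ~~ b (heads_of T) -> reaches (mentry (whilem b m)) T 1 T.
Proof.
move=> /negbTE hb; rewrite -[T in reaches _ _ _ T]act_stay.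
by apply: ReachExit; rewrite /= hb.
Qed.

Lemma reaches_whileS (b : pred heads) m T n1 T1 n2 T2 :
  b (heads_of T) -> reaches (mentry m) T n1 T1 ->
  reaches (mentry (whilem b m)) T1 n2 T2 ->
  reaches (mentry (whilem b m)) T (n1 + n2).+1 T2.
Proof.
set w := whilem b m => hb r1 r2.
apply: (@ReachStep w None (Some (mentry m)) T (stay (heads_of T))).
  by rewrite /w /= hb.
rewrite act_stay; elim: r1 r2 => {T T1 n1 hb} [s T a e|s s' T a n T' e _ IH] r2.
  by apply: (@ReachStep w _ None) r2; rewrite /w /= e.
by apply: (@ReachStep w _ (Some s')) (IH r2); rewrite /w /= e.
Qed.

Record store := Store { inp : seq bool; cnt : nat -> nat; out : seq bool }.

(* The value of a counter is the position of its head; cell 0 carries the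
   mark, so that a counter is zero exactly when its head scans the mark. *)
Definition counter_tape (v m : nat) : tape gsym :=
  let s := rcons (nseq v None) gmark in
  Tape (behead s) (head None s) (nseq m None).

(** Tape 0 is the input, with anything left of its head; the last tape is the output, with its head
    on the blank after the last bit; [m] is the number of blanks listed beyond the head of a
    counter. *)
Definition represents (T : tapes) (st : store) : Prop :=
  [/\ exists l, T ord0 = Tape l (head None (map gbit (inp st)))
                               (behead (map gbit (inp st))),
      forall i : 'I_nt.+1, 0 < i < nt ->
        exists m, T i = counter_tape (cnt st i) m
    & T ord_max = Tape (rev (map gbit (out st))) None [::]].

Definition runs (m : machine) (st st' : store) (t : nat) : Prop :=
  forall T, represents T st -> exists T' n,
    [/\ n <= t, represents T' st' & reaches (mentry m) T n T'].

(** Stores contain functions, so counters are compared pointwise instead of through equality of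
    stores. *)
Lemma runs_weaken m st st' t st1 t1 :
  runs m st st' t -> inp st' = inp st1 -> cnt st' =1 cnt st1 ->
  out st' = out st1 -> t <= t1 -> runs m st st1 t1.
Proof.
move=> h ei ec eo let1 T /h[T' [n [len [r1 r2 r3] r]]]; exists T', n.
split=> //; first exact: leq_trans let1.
by split; rewrite -?ei -?eo // => i hi; rewrite -ec; apply: r2.
Qed.

Lemma runs_pre m st st' t st1 :
  runs m st1 st' t -> inp st = inp st1 -> cnt st =1 cnt st1 ->
  out st = out st1 -> runs m st st' t.
Proof.
move=> h ei ec eo T [r1 r2 r3]; apply: h.
by split; rewrite -?ei -?eo // => i hi; rewrite -ec; apply: r2.
Qed.

Lemma runs_seq m1 m2 st st1 st2 t1 t2 :
  runs m1 st st1 t1 -> runs m2 st1 st2 t2 ->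
  runs (seqm m1 m2) st st2 (t1 + t2).
Proof.
move=> h1 h2 T /h1[T1 [n1 [le1 /h2[T2 [n2 [le2 r2 e2]]] e1]]].
exists T2, (n1 + n2); split=> //; first exact: leq_add.
exact: reaches_seq e1 e2.
Qed.

(** [F i] is the store after [i] turns; the bound counts one test per turn and the final failing
    one. *)
Lemma runs_while (b : pred heads) m (F : nat -> store) v t :
  (forall i T, i < v -> represents T (F i) -> b (heads_of T)) ->
  (forall T, represents T (F v) -> ~~ b (heads_of T)) ->
  (forall i, i < v -> runs m (F i) (F i.+1) t) ->
  runs (whilem b m) (F 0) (F v) (v * t.+1).+1.
Proof.
elim: v F => [|v IHv] F ht hf hm T r.
  by exists T, 1; split=> //; apply/reaches_while0/hf.
have [T1 [n1 [le1 r1 e1]]] := hm 0 isT T r.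
have [|||T2 [n2 [le2 r2 e2]]] := IHv (F \o succn) _ _ _ T1 r1.
- by move=> i T' lti; apply: ht.
- exact: hf.
- by move=> i lti; apply: hm.
exists T2, (n1 + n2).+1; split=> //.
  by rewrite ltnS mulSn addSn -addnS leq_add.
by apply: reaches_whileS e1 e2; apply: ht r.
Qed.

Lemma runs_if (b : pred heads) m1 m2 st st' t (c : bool) :
  (forall T, represents T st -> b (heads_of T) = c) ->
  runs (if c then m1 else m2) st st' t -> runs (ifm b m1 m2) st st' t.+1.
Proof.
move=> hb h T r; have [T' [n [len r' e]]] := h T r; exists T', n.+1; split=> //.
by apply: reaches_if; rewrite hb.
Qed.

Definition setc (c v : nat) (st : store) : store :=
  Store (inp st) (fun x => if x == c then v else cnt st x) (out st).

Definition addc (c v : nat) (st : store) : store := setc c (cnt st c + v) st.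

Definition writes (s : seq bool) (st : store) : store :=
  Store (inp st) (cnt st) (out st ++ s).

Definition movec (mv : move) (c : nat) : machine :=
  prim (fun h => [ffun i => (h i, if val i == c then mv else MoveN)]).

Definition emit1 (b : bool) : machine :=
  prim (fun h => [ffun i => if i == ord_max then (gbit b, MoveR)
                            else (h i, MoveN)]).

Fixpoint emits (s : seq bool) : machine :=
  if s is b :: s' then seqm (emit1 b) (emits s') else prim stay.

Lemma runs_movec mv c st st' :
  0 < c < nt -> inp st' = inp st -> out st' = out st ->
  (forall x, x != c -> cnt st' x = cnt st x) ->
  (forall m, exists m', tape_act None (counter_tape (cnt st c) m)
       (head None (rcons (nseq (cnt st c) None) gmark), mv)
     = counter_tape (cnt st' c) m') ->
  runs (movec mv c) st st' 1.
Proof.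
move=> hc ei eo ex ec T [[l r1] r2 r3].
eexists; exists 1; split=> //; last by apply: ReachExit; rewrite /=;
  reflexivity.
split; rewrite ?ei ?eo.
- exists l; rewrite !ffunE /= r1.
  by case: eqP hc => // <-.
- move=> i hi; rewrite !ffunE; have [m ->] := r2 i hi.
  have [e|ne] := eqVneq (val i) c; last by exists m; rewrite ex.
  by rewrite [nat_of_ord i]e; apply: ec.
- rewrite !ffunE /= r3.
  by case: eqP hc => // <-; rewrite ltnn andbF.
Qed.

Lemma runs_inc c st : 0 < c < nt -> runs (movec MoveR c) st (addc c 1 st) 1.
Proof.
move=> hc; apply: runs_movec => //= [x /negbTE -> //|m].
(* Moving right uses up a listed blank, or a fresh one when none is listed. *)
rewrite eqxx addn1; case: m => [|m]; [exists 0 | exists m].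
  by case: (cnt st c).
by case: (cnt st c).
Qed.

Lemma runs_dec c st v : 0 < c < nt -> cnt st c = v.+1 ->
  runs (movec MoveL c) st (setc c v st) 1.
Proof.
move=> hc ec; apply: runs_movec => //= [x /negbTE -> //|m].
rewrite eqxx ec; exists m.+1.
by case: v ec.
Qed.

Lemma runs_emits s st : runs (emits s) st (writes s st) (size s).+1.
Proof.
elim: s st => [|b s IHs] st.
  apply: (@runs_weaken _ _ st 1) => //; last by rewrite /= cats0.
  move=> T r; exists T, 1; split=> //;
    rewrite -[in X in reaches _ _ _ X](act_stay T).
  exact: ReachExit.
apply: (@runs_weaken _ _ (writes s (writes [:: b] st)) (1 + (size s).+1)) => //;
  last by rewrite /= -catA.
apply: runs_seq (@IHs _) => T [[l r1] r2 r3].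
eexists; exists 1; split=> //; last by apply: ReachExit; rewrite /=;
  reflexivity.
split.
- exists l; rewrite !ffunE /= r1.
  by case: eqP => // /(congr1 val) /= e; move: nt_gt0; rewrite -e.
- move=> i hi; rewrite !ffunE; have [m ->] := r2 i hi.
  case: eqP => [e|_]; last by exists m.
  by move: hi; rewrite e ltnn andbF.
- by rewrite !ffunE eqxx r3 /= map_cat rev_cat.
Qed.

Definition nonzero (c : nat) : pred heads := fun h => h (inord c) != gmark.

Lemma nonzeroE c T st : 0 < c < nt -> represents T st ->
  nonzero c (heads_of T) = (cnt st c != 0).
Proof.
move=> hc [_ r _]; have e : (inord c : 'I_nt.+1) = c :> nat.
  by apply: inordK; rewrite ltnS ltnW //; case/andP: hc.
have [|m] := r (inord c); first by rewrite e.
rewrite /nonzero ffunE => ->; rewrite e.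
by case: (cnt st c).
Qed.

(* The value of [c] is parked in the scratch counter [s], which must be zero,
   and restored at the end. *)
Definition form (c s : nat) (m : machine) : machine :=
  seqm (whilem (nonzero c) (seqm (movec MoveL c) (seqm (movec MoveR s) m)))
       (whilem (nonzero s) (seqm (movec MoveL s) (movec MoveR c))).

(** [F i] has [c] and [s] at rest; the body itself runs while they hold [v - i.+1] and [i.+1]. A
    turn costs [t + 3] in the first loop and 3 in the second, and each loop ends with a failing
    test. *)
Lemma runs_for c s m (F : nat -> store) v t :
  0 < c < nt -> 0 < s < nt -> c != s ->
  (forall i, i <= v -> cnt (F i) c = v /\ cnt (F i) s = 0) ->
  (forall i, i < v -> runs m (setc c (v - i.+1) (setc s i.+1 (F i)))
                            (setc c (v - i.+1) (setc s i.+1 (F i.+1))) t) ->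
  runs (form c s m) (F 0) (F v) (v * (t + 6) + 2).
Proof.
move=> hc hs ncs hF hm.
(* [G] and [H] give the stores met by the draining loop and by the restoring loop. *)
pose G i := setc c (v - i) (setc s i (F i)).
pose H i := setc c i (setc s (v - i) (F v)).
have h1 : runs (whilem (nonzero c) (seqm (movec MoveL c)
                 (seqm (movec MoveR s) m))) (G 0) (G v) (v * (1 + (1 +
                   t)).+1).+1.
  apply: runs_while => [i T lti /(nonzeroE hc) ->|T /(nonzeroE hc) ->|i lti].
  - by rewrite /= eqxx -lt0n subn_gt0.
  - by rewrite /= eqxx subnn.
  apply: runs_seq (runs_dec (v := v - i.+1) hc _) _.
    by rewrite /= eqxx; lia.
  apply: runs_seq (runs_inc hs) _.
  apply: (runs_pre (hm i lti)) => // x; rewrite /= eqxx.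
  rewrite [s == c]eq_sym (negbTE ncs) addn1.
  by case: (x =P s) => [->|_]; [rewrite eq_sym (negbTE ncs) | case: (x == c)].
have h2 : runs (whilem (nonzero s) (seqm (movec MoveL s) (movec MoveR c)))
            (H 0) (H v) (v * (1 + 1).+1).+1.
  have nsc : s != c by rewrite eq_sym.
  apply: runs_while => [i T lti /(nonzeroE hs) ->|T /(nonzeroE hs) ->|i lti].
  - by rewrite /= eqxx (negbTE nsc) -lt0n subn_gt0.
  - by rewrite /= eqxx (negbTE nsc) subnn.
  apply: runs_seq (runs_dec (v := v - i.+1) hs _) _.
    by rewrite /= eqxx (negbTE nsc); lia.
  apply: runs_weaken (runs_inc hc) _ _ _ _ => // x /=.
  rewrite !eqxx (negbTE ncs) addn1.
  by case: (x == c) => //; case: (x == s).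
apply: (@runs_weaken _ _ (H v) ((v * (1 + (1 + t)).+1).+1 + (v * (1 +
  1).+1).+1)) => //.
- apply: runs_seq h2; apply: runs_weaken (runs_pre h1 _ _ _) _ _ _ _ => //.
  + move=> x /=; have [e1 e2] := hF 0 isT.
    by rewrite subn0; case: eqP => [->//|_]; case: eqP => [->|].
  + by move=> x /=; rewrite subnn subn0.
- move=> x /=; have [e1 e2] := hF v (leqnn v).
  by rewrite subnn; case: eqP => [->//|_]; case: eqP => [->|].
- by lia.
Qed.


Definition scanning (o : gsym) : pred heads := fun h => h ord0 == o.

Lemma scanningE o T st : represents T st ->
  scanning o (heads_of T) = (head None (map gbit (inp st)) == o).
Proof. by case=> [[l e] _ _]; rewrite /scanning ffunE e. Qed.

Definition advance : machine :=
  prim (fun h => [ffun i => (h i, if i == ord0 then MoveR else MoveN)]).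

Lemma runs_advance st b w : inp st = b :: w ->
  runs advance st (Store w (cnt st) (out st)) 1.
Proof.
move=> ei T [[l r1] r2 r3].
eexists; exists 1; split=> //; last by apply: ReachExit; rewrite /=;
  reflexivity.
split=> /=.
- by exists (gbit b :: l); rewrite !ffunE eqxx r1 ei.
- move=> i hi; rewrite !ffunE; have [m ->] := r2 i hi.
  case: eqP => [e|_]; last by exists m.
  by move: hi; rewrite e.
- rewrite !ffunE r3; case: eqP => // /(congr1 val) /= e.
  by move: nt_gt0; rewrite e.
Qed.

Definition mark_counters : machine :=
  prim (fun h => [ffun i : 'I_nt.+1 =>
                   (if 0 < i < nt then gmark else h i, MoveN)]).

Definition initial_tapes (w : seq bool) : tapes :=
  [ffun i => load_tape None (if i == ord0 then map gbit w else [::])].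

Lemma reaches_mark_counters w : exists T,
  represents T (Store w (fun=> 0) [::]) /\
  reaches (mentry mark_counters) (initial_tapes w) 1 T.
Proof.
eexists; split; last by apply: ReachExit; rewrite /=; reflexivity.
split=> /=.
- by exists [::]; rewrite !ffunE.
- move=> i hi; exists 0; rewrite !ffunE hi.
  by case: eqP hi => [->|].
- rewrite !ffunE ltnn andbF; case: eqP => // /(congr1 val) /= e.
  by move: nt_gt0; rewrite e.
Qed.

Definition tm_of (m : machine) : TM.
Proof.
refine (@MkTM nt (mstate m + bool)%type gsym None gbit (inl (mentry m))
  (inr true) (inr false)
  (fun q h => match q with
     | inl s => let: (o, a) := mtrans s h in
                (if o is Some s' then inl s' else inr true, a)
     | inr c => (inr c, stay h)
     end) _ _ _) => //.
by move=> b c [].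
Defined.

Lemma tm_of_reaches (m : machine) (s : mstate m) T n T' :
  reaches s T n T' ->
  iter n (@tm_step (tm_of m)) (@Config (tm_of m) (inl s) T) =
  @Config (tm_of m) (inr true) T'.
Proof.
elim=> {T n T'} [{}s T a e|{}s s' T a n T' e _ IH]; rewrite ?iterSr.
  by rewrite /= /tm_step /= -/(heads_of T) e.
by rewrite -IH /tm_step /= -/(heads_of T) e.
Qed.

Lemma tm_of_computes (m : machine) (f : seq bool -> seq bool) (t : nat -> nat) :
  (forall w, exists2 st, runs m (Store w (fun=> 0) [::]) st (t (size w)) &
                         out st = f w) ->
  computes_in_time (tm_of (seqm mark_counters m)) f (fun n => (t n).+1).
Proof.
move=> hm w; have [st hr ho] := hm w.
have [T [rT eT]] := reaches_mark_counters w.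
have [T' [n [len [_ _ r3] eT']]] := hr T rT.
exists (1 + n); split; first by rewrite add1n ltnS.
have -> : tm_run (tm_of (seqm mark_counters m)) w (1 + n) =
          @Config (tm_of (seqm mark_counters m)) (inr true) T'.
  exact: tm_of_reaches (reaches_seq eT eT').
(* One padding blank: the output head stands just past the last bit. *)
by split=> //; exists 1; rewrite /= r3 /tape_cells /= revK -ho.
Qed.

End Machines.

Arguments runs_emits {nt} nt_gt0 s {st}.
Arguments runs_inc {nt c st}.
Arguments runs_advance {nt} nt_gt0 {st b w}.

(** * Polynomial bounds *)

Lemma poly_bounded_le (f g : nat -> nat) :
  poly_bounded f -> (forall n, g n <= f n) -> poly_bounded g.
Proof. by move=> [c [d h]] le; exists c, d => n; apply: leq_trans (h n). Qed.

Lemma poly_bounded_const c : poly_bounded (fun=> c).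
Proof. by exists c, 0 => n; rewrite leq_addl. Qed.

Lemma poly_bounded_id : poly_bounded id.
Proof. by exists 1, 1 => n; rewrite mul1n expn1 leq_addr. Qed.

Lemma leq_expn (m n d : nat) : m <= n -> m ^ d <= n ^ d.
Proof. by case: d => // d; rewrite leq_exp2r. Qed.

(** Without an additive term, and with a base that is never 0, bounds are combined under sums and
    products by adding exponents. *)
Lemma poly_bounded_succ_exp (f : nat -> nat) :
  poly_bounded f <-> exists c d, forall n, f n <= c * n.+1 ^ d.
Proof.
split=> [[c [d h]]|[c [d h]]].
  exists (c + c), d => n; apply: leq_trans (h n) _; rewrite mulnDl leq_add //.
    by rewrite leq_mul // leq_expn.
  by rewrite leq_pmulr // expn_gt0.
(* [2 ^ d] comes from [n + 1 <= 2 * n] for positive [n]; the additive constant covers [n = 0]. *)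
exists (c * 2 ^ d), d => n; apply: leq_trans (h n) _.
case: n => [|n].
  apply: leq_trans (leq_addl _ _); rewrite exp1n muln1.
  by rewrite leq_pmulr // expn_gt0.
apply: leq_trans (leq_addr _ _); rewrite -mulnA leq_mul // -expnMn.
by apply: leq_expn; lia.
Qed.

Lemma poly_bounded_add (f g : nat -> nat) :
  poly_bounded f -> poly_bounded g -> poly_bounded (fun n => f n + g n).
Proof.
move=> /poly_bounded_succ_exp[c [d h]] /poly_bounded_succ_exp[c' [d' h']].
apply/poly_bounded_succ_exp; exists (c + c'), (d + d') => n.
rewrite mulnDl leq_add //.
  by apply: leq_trans (h n) _; rewrite leq_mul // leq_pexp2l // leq_addr.
by apply: leq_trans (h' n) _; rewrite leq_mul // leq_pexp2l // leq_addl.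
Qed.

Lemma poly_bounded_mul (f g : nat -> nat) :
  poly_bounded f -> poly_bounded g -> poly_bounded (fun n => f n * g n).
Proof.
move=> /poly_bounded_succ_exp[c [d h]] /poly_bounded_succ_exp[c' [d' h']].
apply/poly_bounded_succ_exp; exists (c * c'), (d + d') => n.
by rewrite expnD mulnACA leq_mul.
Qed.

Lemma poly_bounded_exp (f : nat -> nat) d :
  poly_bounded f -> poly_bounded (fun n => f n ^ d).
Proof.
move=> h; elim: d => [|d IHd]; first exact: poly_bounded_const.
by apply: poly_bounded_le (poly_bounded_mul h IHd) _ => n; rewrite expnS.
Qed.

(** * Writing the encoded instance in polynomial time *)

Definition stairs (X : seq bool) (n : nat) : seq bool :=
  flatten [seq X ++ enc_unary i | i <- iota 0 n].

Lemma stairsS X n : stairs X n.+1 = stairs X n ++ X ++ enc_unary n.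
Proof. by rewrite /stairs iota_rcons map_rcons flatten_rcons. Qed.

Section Template.
Variables (d b : nat) (A0 A1 A2 A3 X Y Bk : seq bool) (B : bool -> seq bool).

(** The words [B] become the input cells, the copies of [Bk] the padding of the queue, and the two
    [stairs] the numbered input gates and output numbers; all other words are constant. *)
Definition template (w : seq bool) : seq bool :=
  let k := (size w + b) ^ d in
  A0 ++ flatten (map B w) ++ flatten (nseq k Bk) ++ A1 ++
  stairs X (size w + k) ++ A2 ++ stairs Y (size w + k) ++ A3.

(** [cB] holds [size w + b], [cN] the length of the stairs, [cI] and [cJ] their step indices; [s1]
    and [s2] serve outer and inner loops; [cK i] holds the [i]-th power of [cB]. The last counter is
    [cK d], number [d + 7]. *)
Let nt := d + 8.
Local Notation cB := 1.
Local Notation cN := 2.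
Local Notation cI := 3.
Local Notation cJ := 4.
Local Notation s1 := 5.
Local Notation s2 := 6.
Local Notation cK i := (7 + i).
Local Notation inc c := (movec nt MoveR c).

Let nt_gt0 : 0 < nt. Proof. by rewrite /nt; lia. Qed.

Ltac bnd := by rewrite /nt; lia.

Ltac pointwise :=
  move=> x /=;
  repeat match goal with |- context [?m == ?n] => case: (@eqP _ m n) => ? end;
  subst; try lia.

Fixpoint incs (c n : nat) : machine nt :=
  if n is n'.+1 then seqm (incs c n') (inc c) else emits nt [::].

Lemma runs_incs c n st : 0 < c < nt -> runs (incs c n) st (addc c n st) (n + 1).
Proof.
move=> hc; elim: n => [|n IHn].
  apply: runs_weaken (runs_emits nt_gt0 [::]) _ _ _ _ => //=;
    last by rewrite cats0.
  by move=> x /=; case: eqP => [->|//]; rewrite addn0.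
apply: runs_weaken (runs_seq IHn (runs_inc hc)) _ _ _ _ => //=; last by lia.
by pointwise.
Qed.

Definition read_input : machine nt :=
  let body c := seqm (emits nt (B c))
                  (seqm (inc cB) (seqm (inc cN) (advance nt))) in
  whilem (fun h => ~~ scanning (nt := nt) None h)
    (ifm (scanning (Some (Some true))) (body true) (body false)).

Definition read_time (n : nat) : nat :=
  n * (size (B true) + size (B false) + 6) + 1.

Lemma runs_read_input st :
  runs read_input st
    (Store [::] (cnt (addc cB (size (inp st)) (addc cN (size (inp st)) st)))
       (out st ++ flatten (map B (inp st)))) (read_time (size (inp st))).
Proof.
set w := inp st.
pose F i := Store (drop i w) (cnt (addc cB i (addc cN i st)))
                  (out st ++ flatten (map B (take i w))).
have h : runs read_input (F 0) (F (size w))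
   (size w * (size (B true) + size (B false) + 5).+1).+1.
  apply: runs_while => [i T lti /scanningE ->|T /scanningE ->|i lti] /=.
  - by rewrite (drop_nth false lti).
  - by rewrite drop_size.
  have hdrop := drop_nth false lti; set c := nth _ _ _ in hdrop.
  rewrite addnS; apply: (runs_if (c := c)) => [T /scanningE -> /=|].
    by rewrite hdrop; case: c {hdrop}.
  pose m := seqm (emits nt (B c)) (seqm (inc cB) (seqm (inc cN) (advance nt))).
  have hm : runs m (F i) (F i.+1) ((size (B c)).+1 + (1 + (1 + 1))).
    apply: runs_seq (runs_emits nt_gt0 _) _.
    apply: runs_seq; first by apply: runs_inc => //; bnd.
    apply: runs_seq; first by apply: runs_inc => //; bnd.
    apply: runs_weaken.
      by apply: (@runs_advance _ nt_gt0 _ c (drop i.+1 w)); exact: hdrop.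
    - by [].
    - by move=> [|[|[|x]]] //=; lia.
    - rewrite /= (take_nth false lti) map_rcons flatten_rcons -/c.
      by rewrite !catA.
    - by [].
  have -> : (if c then seqm (emits nt (B true))
                  (seqm (inc cB) (seqm (inc cN) (advance nt)))
     else seqm (emits nt (B false))
                  (seqm (inc cB) (seqm (inc cN) (advance nt)))) = m.
    by rewrite /m; case: (c).
  by apply: runs_weaken hm _ _ _ _ => //; case: (c); lia.
apply: runs_weaken (runs_pre h _ _ _) _ _ _ _ => //=.
- by rewrite drop0.
- by move=> [|[|[|x]]] //=; lia.
- by rewrite take0 cats0.
- by rewrite drop_size.
- by rewrite take_size.
- by rewrite /read_time; lia.
Qed.

Definition mul_into (c c' : nat) : machine nt :=
  form c s1 (form cB s2 (inc c')).

Lemma runs_mul_into c c' st :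
  6 < c < nt -> 6 < c' < nt -> c != c' -> cnt st s1 = 0 -> cnt st s2 = 0 ->
  runs (mul_into c c') st (addc c' (cnt st c * cnt st cB) st)
       (cnt st c * (cnt st cB * 7 + 8) + 2).
Proof.
move=> hc hc' ncc e1 e2; set v := cnt st c; set u := cnt st cB.
pose F i := addc c' (i * u) st.
have -> : u * 7 + 8 = u * (1 + 6) + 2 + 6 by lia.
apply: runs_weaken (runs_pre (runs_for nt_gt0 (F := F) (v := v) _ _ _ _ _) _
  _ _)
  _ _ _ _ => //=; try bnd.
- by move=> i _; split=> /=; case: eqP => //; lia.
- move=> i lti; set st1 := setc _ _ _.
  pose G j := addc c' j st1.
  apply: runs_weaken (runs_pre (runs_for nt_gt0 (F := G) (v := u) _ _ _ _ _) _
    _ _)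
    _ _ _ _ => //=; try bnd.
  + by move=> j _; split=> /=; repeat (case: eqP => //; try lia).
  + move=> j ltj; apply: runs_weaken (runs_inc _) _ _ _ _ => //; first by bnd.
    by pointwise.
  + by pointwise.
  + by pointwise.
- by pointwise.
Qed.

Fixpoint powers (j : nat) : machine nt :=
  if j is j'.+1 then seqm (powers j') (mul_into (cK j') (cK j'.+1))
  else inc (cK 0).

Fixpoint powers_time (j n : nat) : nat :=
  if j is j'.+1 then powers_time j' n + (n ^ j' * (n * 7 + 8) + 2) else 1.

(** Multiplication adds to its target, so the induction also carries that the counters above [cK j]
    are untouched, hence still zero. *)
Lemma runs_powers j st :
  j <= d -> (forall x, 4 < x -> cnt st x = 0) ->
  exists2 st', runs (powers j) st st' (powers_time j (cnt st cB)) &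
    [/\ inp st' = inp st, out st' = out st,
        forall x, x < 7 \/ 7 + j < x -> cnt st' x = cnt st x
      & cnt st' (cK j) = cnt st cB ^ j].
Proof.
move=> + st0; elim: j => [|j IHj] lejd.
  exists (addc (cK 0) 1 st); first by apply: runs_inc; bnd.
  split=> //= [x hx|]; last by rewrite st0.
  by case: eqP => //; lia.
have [st' h [ei eo ec ek]] := IHj (ltnW lejd).
exists (addc (cK j.+1) (cnt st cB ^ j.+1) st').
  apply: runs_seq h _.
  have eB : cnt st' cB = cnt st cB by apply: ec; left.
  have hm : runs (mul_into (cK j) (cK j.+1)) st'
      (addc (cK j.+1) (cnt st' (cK j) * cnt st' cB) st')
      (cnt st' (cK j) * (cnt st' cB * 7 + 8) + 2).
    by apply: runs_mul_into; rewrite ?ec ?st0 //; try bnd; left.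
  by rewrite ek eB -expnSr in hm.
split=> //= [x hx|].
  by case: eqP => [|_]; [lia | apply: ec; lia].
have e0 : cnt st' (cK j.+1) = 0 by rewrite ec ?st0; lia.
by rewrite eqxx; move: e0; rewrite /= => ->.
Qed.

Definition emit_blanks : machine nt :=
  form (cK d) s1 (seqm (emits nt Bk) (inc cN)).

Lemma runs_emit_blanks st :
  cnt st s1 = 0 -> let k := cnt st (cK d) in
  runs emit_blanks st (addc cN k (writes (flatten (nseq k Bk)) st))
       (k * (size Bk + 8) + 2).
Proof.
move=> e1 k; pose F i := addc cN i (writes (flatten (nseq i Bk)) st).
apply: runs_weaken (runs_pre (runs_for nt_gt0 (F := F) (v := k)
  (t := (size Bk).+1 + 1) _ _ _ _ _) _ _ _) _ _ _ _ => //=; try bnd.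
- move=> i lti; apply: runs_seq (runs_emits nt_gt0 _) _.
  apply: runs_weaken (runs_inc _) _ _ _ _ => //; first by bnd.
  + by pointwise.
  + rewrite /= -catA; congr (_ ++ _).
    by elim: (i) => [|i' /= IH]; rewrite ?cats0 //= -catA IH.
- by pointwise.
- by rewrite cats0.
Qed.

(** [c] counts the turns and gives the length of the unary word. It is not reset, so each of the two
    stairs has its own counter. *)
Definition emit_stairs (c : nat) (Z : seq bool) : machine nt :=
  form cN s1 (seqm (emits nt Z) (seqm (form c s2 (emits nt [:: true]))
                  (seqm (emits nt [:: false]) (inc c)))).

Lemma runs_emit_stairs c Z st :
  2 < c < 5 -> cnt st c = 0 -> cnt st s1 = 0 -> cnt st s2 = 0 ->
  let n := cnt st cN in
  runs (emit_stairs c Z) st (addc c n (writes (stairs Z n) st))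
       (n * (n * 8 + size Z + 12) + 2).
Proof.
move=> hc e0 e1 e2 n; pose F i := addc c i (writes (stairs Z i) st).
apply: runs_weaken (runs_pre (runs_for nt_gt0 (F := F) (v := n)
  (t := (size Z).+1 + ((n * (2 + 6) + 2) + (2 + 1))) _ _ _ _ _) _ _ _)
  _ _ _ _ => //=; try bnd.
- by move=> i _; split=> /=; case: eqP => //; lia.
- move=> i lti; apply: runs_seq (runs_emits nt_gt0 _) _.
  set st1 := writes _ _; pose G j := writes (nseq j true) st1.
  (* This turn needs only [i] rounds; bounding them by [n] makes the cost uniform in [i]. *)
  apply: (runs_seq (st1 := G i) (t1 := n * (2 + 6) + 2)).
    apply: runs_weaken (runs_pre (runs_for nt_gt0 (F := G) (v := i)
      (t := 2) _ _ _ _ _) _ _ _) _ _ _ _ => //=; try bnd.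
    + move=> j _; rewrite e0 e2; split; repeat (case: eqP => //; try lia).
    + move=> j _; apply: runs_weaken (runs_emits nt_gt0 [:: true]) _ _ _ _
      => //=.
      by rewrite -catA; congr (_ ++ _); elim: (j) => //= j' ->.
    + by rewrite cats0.
  apply: runs_seq (runs_emits nt_gt0 [:: false]) _.
  apply: runs_weaken (runs_inc _) _ _ _ _ => //; first by bnd.
  + by pointwise.
  + by rewrite /= stairsS /enc_unary !catA.
- by pointwise.
- by rewrite cats0.
Qed.

Definition template_machine : machine nt :=
  seqm (emits nt A0) (seqm (incs cB b) (seqm read_input (seqm (powers d)
  (seqm emit_blanks (seqm (emits nt A1) (seqm (emit_stairs cI X)
  (seqm (emits nt A2) (seqm (emit_stairs cJ Y) (emits nt A3))))))))).

Definition template_time (n : nat) : nat :=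
  let k := (n + b) ^ d in let m := n + k in
  (size A0).+1 + ((b + 1) + (read_time n + (powers_time d (n + b) +
  ((k * (size Bk + 8) + 2) + ((size A1).+1 + ((m * (m * 8 + size X + 12) + 2) +
  ((size A2).+1 + ((m * (m * 8 + size Y + 12) + 2) + (size A3).+1)))))))).

Lemma template_computes w :
  exists2 st, runs template_machine (Store w (fun=> 0) [::]) st
                   (template_time (size w)) & out st = template w.
Proof.
pose n := size w; pose k := (n + b) ^ d.
pose st1 := Store [::] (cnt (addc cB (n + b) (addc cN n (Store w (fun=> 0)
  [::]))))
              (A0 ++ flatten (map B w)).
have [|st2 h2 [ei2 eo2 ec2 ek2]] := @runs_powers d st1 (leqnn d).
  by pointwise.
have e2 x : 2 < x < 7 -> cnt st2 x = 0.
  by move=> hx; rewrite ec2 /=; repeat (case: eqP); lia.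
have eN : cnt st2 cN = n by rewrite ec2 /=; lia.
rewrite [cnt st1 cB]/= add0n -/k in h2 ek2.
pose st3 := addc cN k (writes (flatten (nseq k Bk) ++ A1) st2).
pose st4 := addc cI (n + k) (writes (stairs X (n + k) ++ A2) st3).
pose st5 := addc cJ (n + k) (writes (stairs Y (n + k) ++ A3) st4).
exists st5; last first.
  by rewrite /= eo2 /template -/n -/k /= !catA.
apply: runs_seq (runs_emits nt_gt0 _) _.
apply: runs_seq; first by apply: runs_incs; bnd.
apply: (runs_seq (st1 := st1)).
  apply: runs_weaken (@runs_read_input _) _ _ _ _ => //=.
  by pointwise.
apply: runs_seq h2 _.
apply: (runs_seq (st1 := addc cN k (writes (flatten (nseq k Bk)) st2))).
  apply: runs_weaken (@runs_emit_blanks _ _) _ _ _ _ => //=; rewrite ?ek2 //.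
  by rewrite e2.
apply: (runs_seq (st1 := st3)).
  by apply: runs_weaken (runs_emits nt_gt0 _) _ _ _ _ => //=; rewrite !catA.
have eN3 : cnt st3 cN = n + k by rewrite /= eN.
apply: (runs_seq (st1 := addc cI (n + k) (writes (stairs X (n + k)) st3))).
  rewrite -eN3; apply: runs_emit_stairs => //=; exact: e2.
apply: (runs_seq (st1 := st4)).
  by apply: runs_weaken (runs_emits nt_gt0 _) _ _ _ _ => //=; rewrite !catA.
apply: (runs_seq (st1 := addc cJ (n + k) (writes (stairs Y (n + k)) st4))).
  have eN4 : cnt st4 cN = n + k by [].
  by rewrite -eN4; apply: runs_emit_stairs => //=; apply: e2.
by apply: runs_weaken (runs_emits nt_gt0 _) _ _ _ _ => //=; rewrite !catA.
Qed.

Lemma poly_time_template : poly_time_computable template.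
Proof.
exists (tm_of (seqm (mark_counters nt) template_machine)).
exists (fun n => (template_time n).+1); split; last first.
  by apply: tm_of_computes => //; exact: template_computes.
have hb : poly_bounded (fun n => n + b).
  by apply: poly_bounded_add; [exact: poly_bounded_id | exact:
    poly_bounded_const].
have hX j : poly_bounded (fun n => (n + b) ^ j) by exact: poly_bounded_exp.
have hm : poly_bounded (fun n => n + (n + b) ^ d).
  by apply: poly_bounded_add => //; apply: poly_bounded_id.
have hP j : poly_bounded (fun n => powers_time j (n + b)).
  elim: j => [|j IHj] /=; first exact: poly_bounded_const.
  by do ![exact: poly_bounded_const | exact: hb | exact: hX | exact: IHj
         | apply: poly_bounded_add | apply: poly_bounded_mul].
apply: (@poly_bounded_le (fun n => 1 + template_time n)) => //.
by rewrite /template_time /read_time; cbv zeta;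
   do ![exact: poly_bounded_const | exact: poly_bounded_id | exact: hm
       | exact: hP | exact: hX
       | apply: poly_bounded_add | apply: poly_bounded_mul].
Qed.

End Template.

Import Order.TTheory GRing.Theory Num.Theory.

(** * From queue automata to polynomial recursive sequences *)

Section CircuitValues.
Local Open Scope ring_scope.
Variables (F : comNzRingType) (k : nat) (v : 'I_k -> F).

Definition gate_value (vs : seq F) (g : gate F k) : F :=
  match g with
  | Input i => v i
  | Const c => c
  | Add i j => vs`_i + vs`_j
  | Mul i j => vs`_i * vs`_j
  end.

Definition gate_values (vs : seq F) (gs : seq (gate F k)) : seq F :=
  foldl (fun vs g => rcons vs (gate_value vs g)) vs gs.

Lemma gate_values_cat vs gs gs' :
  gate_values vs (gs ++ gs') = gate_values (gate_values vs gs) gs'.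
Proof. exact: foldl_cat. Qed.

Lemma size_gate_values vs gs :
  size (gate_values vs gs) = (size vs + size gs)%N.
Proof.
elim: gs vs => [|g gs IH] vs; first by rewrite /= addn0.
by rewrite /= IH size_rcons addSnnS.
Qed.

Lemma gate_values_inputs vs (js : seq 'I_k) :
  gate_values vs [seq Input F j | j <- js] = vs ++ map v js.
Proof. by elim: js vs => [|j js IH] vs; rewrite ?cats0 //= IH cat_rcons. Qed.

Lemma meval_gate_polys (gs : seq (gate F k)) j :
  ((gate_polys gs)`_j).@[v] = (gate_values [::] gs)`_j.
Proof.
rewrite /gate_polys /gate_values.
(* The empty accumulator is generalised to a list of polynomials and the list of its values, ready
   for induction; the default 0 of [nth] evaluates to 0. *)
have [vs evs] : exists vs : seq {mpoly F[k]}, vs = [::] by exists [::].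
have -> : [::] = map (fun p => p.@[v]) vs by rewrite evs.
rewrite -{1}evs => {evs}.
elim: gs vs => [|g gs IH] vs /=.
  have [ltj|gej] := ltnP j (size vs); first by rewrite (nth_map 0).
  by rewrite !nth_default ?size_map // meval0.
rewrite IH map_rcons; congr ((foldl _ (rcons _ _) gs)`_j).
have e i : (vs`_i).@[v] = (map (fun p => p.@[v]) vs)`_i.
  have [lti|gei] := ltnP i (size vs); first by rewrite (nth_map 0).
  by rewrite !nth_default ?size_map // meval0.
case: g => [i|c|i i'|i i'] /=.
- exact: mevalXU.
- exact: mevalC.
- by rewrite mevalD !e.
- by rewrite mevalM !e.
Qed.

End CircuitValues.

(** * Compiling expressions into gates *)

Section Expressions.
Local Open Scope ring_scope.
Variable m : nat.

Inductive expr :=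
  | EVar of 'I_m
  | EConst of rat
  | EOp of bool & expr & expr.

Fixpoint eeval (env : seq rat) (e : expr) : rat :=
  match e with
  | EVar i => env`_i
  | EConst c => c
  | EOp o a b => if o then eeval env a * eeval env b
                 else eeval env a + eeval env b
  end.

(* Gates are typed over no variable: the inputs of the expression are read
   through the numbers [< m] of the gates that hold them. *)
Fixpoint compile (n : nat) (e : expr) : seq (gate rat 0) * nat :=
  match e with
  | EVar i => ([::], val i)
  | EConst c => ([:: Const 0 c], n)
  | EOp o a b =>
    let: (ga, ia) := compile n a in
    let: (gb, ib) := compile (n + size ga) b in
    (ga ++ gb ++ [:: if o then Mul rat 0 ia ib else Add rat 0 ia ib],
     n + size ga + size gb)%N
  end.

(** As ['I_0] is empty, compiled gates contain no inputs, and one list serves circuits of every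
    arity. *)
Definition lift_gate (k : nat) (g : gate rat 0) : gate rat k :=
  match g with
  | Input i => Const k 0
  | Const c => Const k c
  | Add i j => Add rat k i j
  | Mul i j => Mul rat k i j
  end.

Lemma eeval_cat env env' e :
  (m <= size env)%N -> eeval (env ++ env') e = eeval env e.
Proof.
move=> le; elim: e => [i|c|o a IHa b IHb] //=; last by rewrite IHa IHb.
by rewrite nth_cat (leq_trans (ltn_ord i) le).
Qed.

Lemma acyclic_from_cat (F : Type) k n (gs gs' : seq (gate F k)) :
  acyclic_from n (gs ++ gs') =
  acyclic_from n gs && acyclic_from (n + size gs)%N gs'.
Proof.
elim: gs n => [|g gs IH] n /=; first by rewrite addn0.
by rewrite IH addSnnS andbA.
Qed.

Lemma acyclic_from_map_lift k n gs :
  acyclic_from n (map (@lift_gate k) gs) = acyclic_from n gs.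
Proof. by elim: gs n => //= g gs IH n; rewrite IH; case: g => //= -[]. Qed.

(** Compilation only appends gates: earlier gates keep their numbers and values, and the first [m]
    values, which the variables read, are never disturbed. *)
Lemma compile_correct k (v : 'I_k -> rat) vs e : (m <= size vs)%N ->
  let: (gs, j) := compile (size vs) e in
  let gs' := map (@lift_gate k) gs in
  [/\ acyclic_from (size vs) gs, (j < size vs + size gs)%N &
      exists2 vs', gate_values v vs gs' = vs ++ vs' &
                   (vs ++ vs')`_j = eeval vs e].
Proof.
elim: e vs => [i|c|o a IHa b IHb] vs le /=.
- split=> //; first by rewrite addn0 (leq_trans (ltn_ord i)).
  by exists [::]; rewrite ?cats0.
- split=> //; first by rewrite addn1.
  by exists [:: c]; rewrite ?cats1 // nth_rcons ltnn eqxx.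
have := IHa vs le; case: (compile _ a) => ga ia [aca lta [va eva ea]].
have sva : size va = size ga.
  have := size_gate_values v vs (map (@lift_gate k) ga).
  by rewrite eva size_cat size_map => /addnI.
have := IHb (vs ++ va).
rewrite size_cat sva => /(_ (leq_trans le (leq_addr _ _))).
case: (compile _ b) => gb ib [acb ltb [vb evb eb]].
have svb : size vb = size gb.
  have := size_gate_values v (vs ++ va) (map (@lift_gate k) gb).
  by rewrite evb !size_cat size_map => /addnI.
split.
- rewrite !acyclic_from_cat aca acb /= andbT.
  by case: o; rewrite /= ltb (leq_trans lta) ?leq_addr.
- by rewrite !size_cat /= -addnA !ltn_add2l addn1.
pose z := if o then eeval vs a * eeval vs b else eeval vs a + eeval vs b.
exists (va ++ vb ++ [:: z]); last first.
  by rewrite !catA nth_cat !size_cat sva svb ltnn subnn.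
rewrite !map_cat !gate_values_cat eva evb /= !catA cats1; congr rcons.
have ea' : ((vs ++ va) ++ vb)`_ia = eeval vs a.
  by rewrite nth_cat size_cat sva lta.
by rewrite /z; case: (o); rewrite /= ea' eb eeval_cat.
Qed.

Lemma compile_wf n e : (m <= n)%N ->
  acyclic_from n (compile n e).1 /\
  ((compile n e).2 < n + size (compile n e).1)%N.
Proof.
move=> le.
(* The structural claims depend only on the length of the list of values, so zeros will do. *)
have := @compile_correct 0 (fun=> 0) (nseq n 0) e; rewrite size_nseq => /(_ le).
by case: compile => C j [].
Qed.

End Expressions.

(** * Lagrange interpolation over finite types *)

Section Interpolation.
Local Open Scope ring_scope.

Definition code (T : finType) (a : T) : rat := (enum_rank a)%:R.

Lemma code_inj (T : finType) : injective (@code T).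
Proof. by move=> a b /eqP; rewrite eqr_nat => /eqP/val_inj/enum_rank_inj. Qed.

Variable m : nat.

Lemma expr_prod (I : Type) (r : seq I) (f : I -> expr m) :
  exists e : expr m, forall env, eeval env e = \prod_(i <- r) eeval env (f i).
Proof.
elim: r => [|i r [e he]]; first by exists (EConst m 1) => env; rewrite big_nil.
by exists (EOp true (f i) e) => env; rewrite big_cons /= he.
Qed.

Lemma expr_sum (I : Type) (r : seq I) (f : I -> expr m) :
  exists e : expr m, forall env, eeval env e = \sum_(i <- r) eeval env (f i).
Proof.
elim: r => [|i r [e he]]; first by exists (EConst m 0) => env; rewrite big_nil.
by exists (EOp false (f i) e) => env; rewrite big_cons /= he.
Qed.

(** The Lagrange basis polynomial: the product over [c != a] of
    [(x - code c) / (code a - code c)]. *)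
Lemma expr_indicator (T : finType) (i : 'I_m) (a : T) :
  exists e : expr m, forall env b, env`_i = code b -> eeval env e = (b == a)%:R.
Proof.
have [e he] := expr_prod [seq c <- enum T | c != a]
  (fun c => EOp true (EOp false (EVar i) (EConst m (- code c)))
                 (EConst m (code a - code c)^-1)).
exists e => env b hb; rewrite he; case: eqP => [eb|/eqP ne].
  rewrite big1_seq // => c /=; rewrite mem_filter => /andP[nca _].
  rewrite hb eb mulfV // subr_eq0; apply: contra nca => /eqP/code_inj ->.
  exact: eqxx.
apply/eqP; rewrite prodf_seq_eq0; apply/hasP; exists b.
  by rewrite mem_filter ne mem_enum.
by rewrite /= hb subrr mul0r.
Qed.

(** Sum over all triples the value of [g] times the product of three indicators; only the triple
    [(q, x, y)] contributes. *)
Lemma expr_interpolation (Q A : finType) (i j l : 'I_m) (g : Q -> A -> A ->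
  rat) :
  exists e : expr m, forall env q x y,
    env`_i = code q -> env`_j = code x -> env`_l = code y ->
    eeval env e = g q x y.
Proof.
have hq (q : Q) := expr_indicator i q.
have hx (x : A) := expr_indicator j x.
have hy (y : A) := expr_indicator l y.
have h (p : Q * A * A) : exists e : expr m, forall env q x y,
    env`_i = code q -> env`_j = code x -> env`_l = code y ->
    eeval env e = g p.1.1 p.1.2 p.2 * (p == (q, x, y))%:R.
  have [eq heq] := hq p.1.1; have [ex hex] := hx p.1.2; have [ey hey] := hy p.2.
  exists (EOp true (EConst m (g p.1.1 p.1.2 p.2)) (EOp true eq (EOp true ex
    ey))).
  move=> env q x y eq1 eq2 eq3 /=.
  rewrite (heq _ _ eq1) (hex _ _ eq2) (hey _ _ eq3) -!natrM !mulnb.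
  case: p {heq hex hey} => [[q' x'] y'] /=.
  by rewrite !xpair_eqE [q == _]eq_sym [x == _]eq_sym [y == _]eq_sym andbA.
have [f hf] : exists f : Q * A * A -> expr m, forall p env q x y,
    env`_i = code q -> env`_j = code x -> env`_l = code y ->
    eeval env (f p) = g p.1.1 p.1.2 p.2 * (p == (q, x, y))%:R.
  exact: (fin_all_exists h).
have [e he] := expr_sum (enum {: Q * A * A}) f.
exists e => env q x y e1 e2 e3; rewrite he big_enum /=.
rewrite (bigD1 (q, x, y)) //= big1 ?addr0 => [|p ne];
  rewrite (hf _ _ _ _ _ e1 e2 e3).
  by rewrite eqxx mulr1.
by rewrite (negbTE ne) mulr0.
Qed.

End Interpolation.

(** * Queue automata as polynomial maps *)

Section QueueAutomata.
Variables (Q A : finType) (delta : Q -> A -> A -> Q * A).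

Definition queue_step (c : Q * seq A) : Q * seq A :=
  if c.2 is x :: y :: r then
    let: (q, z) := delta c.1 x y in (q, rcons (y :: r) z)
  else c.

Variable flag : pred Q.

Lemma size_queue_step c : size (queue_step c).2 = size c.2.
Proof.
by case: c => q [|x [|y r]] //; rewrite /queue_step /=; case: delta => q' z;
   rewrite /= size_rcons.
Qed.

Lemma size_iter_queue_step n c : size (iter n queue_step c).2 = size c.2.
Proof. by elim: n => //= n IHn; rewrite size_queue_step. Qed.

Section ToPolyrec.
Local Open Scope ring_scope.

(** The part of a step that is not a shift. Gates 0 to 3 hold the flag, the control and the two
    front symbols; the old flag [f] is never read, and the gates do not depend on the arity. *)
Lemma local_gates : exists (C : seq (gate rat 0)) (fo qo zo : nat),
  [/\ acyclic_from 4 C,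
      [/\ (fo < 4 + size C)%N, (qo < 4 + size C)%N & (zo < 4 + size C)%N]
    & forall k (v : 'I_k -> rat) f q x y,
      let env := [:: f; code q; code x; code y] in
      exists2 vC, gate_values v env (map (@lift_gate k) C) = env ++ vC &
      [/\ (env ++ vC)`_fo = (flag q)%:R,
          (env ++ vC)`_qo = code (delta q x y).1
        & (env ++ vC)`_zo = code (delta q x y).2]].
Proof.
pose i1 : 'I_4 := Ordinal (isT : (1 < 4)%N).
pose i2 : 'I_4 := Ordinal (isT : (2 < 4)%N).
pose i3 : 'I_4 := Ordinal (isT : (3 < 4)%N).
have interp := @expr_interpolation 4 Q A i1 i2 i3.
have [e1 he1] := interp (fun q _ _ => (flag q)%:R).
have [e2 he2] := interp (fun q x y => code (delta q x y).1).
have [e3 he3] := interp (fun q x y => code (delta q x y).2).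
case E1 : (compile 4 e1) => [C1 o1].
case E2 : (compile (4 + size C1) e2) => [C2 o2].
case E3 : (compile (4 + size C1 + size C2) e3) => [C3 o3].
exists (C1 ++ C2 ++ C3), o1, o2, o3.
have := @compile_wf 4 4 e1 isT; rewrite E1 => -[a1 l1].
have := @compile_wf 4 (4 + size C1) e2 isT; rewrite E2 => -[a2 l2].
have := @compile_wf 4 (4 + size C1 + size C2) e3 isT; rewrite E3 => -[a3 l3].
rewrite /= in l1 l2 l3.
split; first by rewrite !acyclic_from_cat a1 a2 a3.
  rewrite !size_cat !addnA; split=> //.
    by rewrite (leq_trans l1) // -addnA leq_addr.
  by rewrite (leq_trans l2) // leq_addr.
move=> k v f q x y env.
have {}he1 := he1 env q x y erefl erefl erefl.
have {}he2 := he2 env q x y erefl erefl erefl.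
have {}he3 := he3 env q x y erefl erefl erefl.
have := compile_correct v (vs := env) e1 isT.
rewrite [size env]/= E1 => -[_ _ [v1 g1 n1]].
have s1 : size v1 = size C1.
  have := size_gate_values v env (map (@lift_gate k) C1).
  by rewrite g1 size_cat size_map => /addnI.
have := compile_correct v (vs := env ++ v1) e2 isT.
rewrite size_cat s1 [size env]/= E2 => -[_ _ [v2 g2 n2]].
have s2 : size v2 = size C2.
  have := size_gate_values v (env ++ v1) (map (@lift_gate k) C2).
  by rewrite g2 size_cat size_map => /addnI.
have := compile_correct v (vs := (env ++ v1) ++ v2) e3 isT.
rewrite !size_cat s1 s2 [size env]/= E3 => -[_ _ [v3 g3 n3]].
exists (v1 ++ v2 ++ v3).
  by rewrite !map_cat !gate_values_cat g1 g2 g3 !catA.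
split.
- by rewrite (catA env) nth_cat size_cat s1 [size env]/= l1 n1.
- by rewrite !catA nth_cat !size_cat s1 s2 [size env]/= l2 n2 eeval_cat.
- by rewrite !catA n3 -catA eeval_cat.
Qed.

Lemma enc_seqE (T : Type) (enc : T -> seq bool) s :
  enc_seq enc s = flatten [seq true :: enc x | x <- s] ++ [:: false].
Proof. by []. Qed.

(** The variables are flag, control and queue. Placing [C] between inputs 0 to 3 and the others
    fixes its gate numbers for all [N]; input [4 + i] is then gate [G + i]. The outputs from [3] to
    [iota G N] shift the queue and [zo] refills its end. The flag lags one step behind the
    control. *)
Lemma queue_polyrec : exists (G : nat) (C : seq (gate rat 0)) (fo qo zo : nat),
  forall (q : Q) (r : seq A) N, size r = N.+2 ->
  exists I : polyrec_input rat,
    [/\ forall n, polyrec_seq I n.+1 = (flag (iter n queue_step (q, r)).1)%:R,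
        polyrec_seq I 0 = 0
      & enc_input I =
        enc_seq enc_rat (0 :: code q :: map (@code _) r) ++
        (flatten [seq [:: true; false; false] ++ enc_unary i | i <- iota 0 4] ++
         flatten [seq true :: enc_gate g | g <- C] ++
         flatten [seq [:: true; false; false] ++ enc_unary i | i <- iota 4 N] ++
         [:: false]) ++
        enc_seq enc_unary ([:: fo; qo; 3%N] ++ iota G N ++ [:: zo])].
Proof.
have [C [fo [qo [zo [aC [lfo lqo lzo] hC]]]]] := local_gates.
exists (4 + size C)%N, C, fo, qo, zo => q r N er; set G := (4 + size C)%N.
pose k := N.+4.
pose inputs s := [seq Input rat (inord j : 'I_k) | j <- s].
pose gs := inputs (iota 0 4) ++ map (@lift_gate k) C ++ inputs (iota 4 N).
pose os := [:: fo; qo; 3%N] ++ iota G N ++ [:: zo].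
pose vec (f : rat) (c : Q * seq A) := f :: code c.1 :: map (@code _) c.2.
have os_size : size os == k by rewrite /os !size_cat size_iota /k /= addn1.
have gs_size : size gs = (G + N)%N.
  by rewrite /gs !size_cat !size_map !size_iota /G addnA.
have wf : wf_circuit gs (Tuple os_size).
  have ac s n : acyclic_from n (inputs s) by elim: s n => /=.
  apply/and3P; split.
  - by rewrite /gs !acyclic_from_cat !ac acyclic_from_map_lift size_map aC.
  - apply/forallP=> i; rewrite /gs !count_cat.
    have -> : count (is_input i) (map (@lift_gate k) C) = 0%N.
      by elim: (C) => //= -[] //= [].
    (* The two blocks of inputs together list each variable below [N + 4] once. *)
    rewrite add0n -count_cat -map_cat -(iotaD 0 4 N) count_map.
    rewrite (@eq_in_count _ _ (pred1 (val i))).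
      by rewrite count_uniq_mem ?iota_uniq // mem_iota ltn_ord.
    move=> j; rewrite mem_iota /= => ltj.
    by rewrite -val_eqE /= inordK.
  - rewrite gs_size /os !all_cat /= (leq_trans lfo) ?leq_addr //.
    rewrite (leq_trans lqo) ?leq_addr // (leq_trans lzo) ?leq_addr //= andbT.
    by apply/allP=> j; rewrite mem_iota => /andP[].
have u_size : size (vec 0 (q, r)) == k by rewrite /vec /= size_map er.
pose I := @PolyrecInput rat N.+3 (Tuple u_size) (Circuit wf).
(* The result does not depend on the old flag [f]. *)
have step f c (v : 'I_k -> rat) (i : 'I_k) :
    size c.2 = N.+2 -> (forall j, v j = (vec f c)`_j) ->
    (circuit_poly (Circuit wf) i).@[v] =
    (vec (flag c.1)%:R (queue_step c))`_i.
  case: c => c [|x [|y r']] // [er'] hv.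
  rewrite /circuit_poly meval_gate_polys [gates _]/= /gs.
  have inputs_val vs s : all (fun j => j < k)%N s ->
      gate_values v vs (inputs s) = vs ++ map (nth 0 (vec f (c, [:: x, y &
        r']))) s.
    rewrite /inputs (map_comp (@Input rat k)) gate_values_inputs -map_comp.
    move=> /allP lts; congr (_ ++ _); apply/eq_in_map => j /lts ltj /=.
    by rewrite hv inordK.
  rewrite !gate_values_cat !inputs_val //; last first.
    by apply/allP=> j; rewrite mem_iota => /andP[].
  rewrite [iota 0 4]/= [map _ [:: _; _; _; _]]/=.
  have [vC gC [hf hq hz]] := hC k v f c x y.
  have svC : size ([:: f; code c; code x; code y] ++ vC) = G.
    by rewrite -gC size_gate_values size_map.
  rewrite {}gC.
  have -> : map (nth 0 (vec f (c, [:: x, y & r']))) (iota 4 N) = map (@code _)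
    r'.
    rewrite map_nth_iota /=; last by rewrite /vec /= size_map er' !subSS subn0.
    by rewrite drop0 take_oversize // size_map er'.
  move: hf hq hz; set vs := _ ++ vC => hf hq hz.
  have -> : tnth (outputs (Circuit wf)) i = nth 0%N os i by rewrite (tnth_nth
    0%N).
  rewrite -(nth_map 0%N 0 (fun o => (vs ++ map (@code _) r')`_o)) ?(eqP
    os_size) //.
  congr nth; rewrite /queue_step /=; move: hq hz; case: delta => q' z /= hq hz.
  have nthC o : (o < G)%N -> (vs ++ [seq code a | a <- r'])`_o = vs`_o.
    by move=> lto; rewrite nth_cat svC lto.
  rewrite !nthC //= hf hq /vec /= map_cat map_rcons -cats1 /= nthC // hz.
  do 3![congr (_ :: _)]; congr (_ ++ _).
  rewrite (map_nth_iota 0 (s := vs ++ _)); last first.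
    by rewrite size_cat svC size_map er' addKn.
  by rewrite drop_size_cat // take_oversize // size_map er'.
have state n (i : 'I_k) :
    polyrec_state (circuit_poly (Circuit wf)) (tnth (Tuple u_size)) n.+1 i =
    (vec (flag (iter n queue_step (q, r)).1)%:R (iter n.+1 queue_step (q,
      r)))`_i.
  elim: n i => [|n IHn] i.
    (* The initial flag is 0 whatever the initial control; [step] allows this. *)
    by apply: (@step 0) => // j; rewrite /= (tnth_nth 0).
  by apply: step IHn; rewrite size_iter_queue_step.
exists I; split.
- by move=> n; rewrite /polyrec_seq state.
- by rewrite /polyrec_seq /= (tnth_nth 0).
have -> : enc_input I = enc_seq enc_rat (vec 0 (q, r)) ++
    enc_seq (@enc_gate k) gs ++ enc_seq enc_unary os by [].
congr (_ ++ (_ ++ _)).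
have enc_inputs s : all (fun j => j < k)%N s ->
    flatten [seq true :: enc_gate g | g <- inputs s] =
    flatten [seq [:: true; false; false] ++ enc_unary j | j <- s].
  elim: s => //= j s IHs /andP[ltj /IHs ->].
  by rewrite inordK.
have enc_lift : [seq true :: enc_gate g | g <- map (@lift_gate k) C] =
                [seq true :: enc_gate g | g <- C].
  by rewrite -map_comp; apply: eq_map => -[[]||i j|i j] //=.
rewrite enc_seqE /gs !map_cat !flatten_cat enc_lift !enc_inputs -?catA //.
by apply/allP=> j; rewrite mem_iota => /andP[].
Qed.

End ToPolyrec.
End QueueAutomata.

(** * Queue automata simulate Turing machines *)

(** Moves are made a finite type so that actions, hence control states, form one. *)
Definition move_to_option (m : move) : option bool :=
  match m with MoveL => Some false | MoveN => None | MoveR => Some true end.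
Definition move_of_option (o : option bool) : move :=
  match o with Some false => MoveL | None => MoveN | Some true => MoveR end.
Lemma move_to_optionK : cancel move_to_option move_of_option.
Proof. by case. Qed.
HB.instance Definition _ := Countable.copy move (can_type move_to_optionK).
HB.instance Definition _ : isFinite move := CanIsFinite move_to_optionK.

Section Simulation.
Variable M : TM.
Local Notation sym := (tm_sym M).
Local Notation blank := (tm_blank M).
Local Notation state := (tm_state M).
Local Notation index := 'I_(ntapes M).+1.
Local Notation tapes := {ffun index -> tape sym}.
Local Notation act := {ffun index -> sym * move}.

(* One position of all the tapes: the symbol of each and whether its head is
   there. *)
Definition cell : finType := {ffun index -> sym * bool}.

(* State of M, action to perform during the current sweep, previous symbol of
   the queue before its update, symbols found under the updated heads.  The
   queue symbol [None] separates the right end of the tapes from the left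
   one. *)
Definition control : finType :=
  (state * act * option cell * {ffun index -> sym})%type.

(** A head arrives from the old left or right neighbour. [prev = None] identifies cell 0, where a
    head moving left stays in place. *)
Definition cell_update (a : act) (prev : option cell) (c : cell)
    (next : option cell) : cell :=
  [ffun t => (if (c t).2 then (a t).1 else (c t).1,
    match (a t).2 with
    | MoveN => (c t).2
    | MoveR => if prev is Some p then (p t).2 else false
    | MoveL => (if next is Some n then (n t).2 else false)
               || ((prev == None) && (c t).2)
    end)].

Definition collect (c : cell) (s : {ffun index -> sym}) : {ffun index -> sym} :=
  [ffun t => if (c t).2 then (c t).1 else s t].

(** A halted machine keeps sweeping with an action that rewrites the scanned symbols, matching
    [tm_step]. *)
Definition next_action (q : state) (s : {ffun index -> sym}) : state * act :=
  if (q == tm_accept M) || (q == tm_reject M)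
  then (q, [ffun t => (s t, MoveN)]) else tm_trans q s.

(** An update needs both old neighbours: the left one is remembered, the right one is peeked at. At
    the separator the collected symbols determine the next state and action. *)
Definition sweep_delta (x : control) (c next : option cell) :
    control * option cell :=
  let: (q, a, prev, s) := x in
  if c is Some c' then
    let c'' := cell_update a prev c' next in
    ((q, a, c, collect c'' s), Some c'')
  else ((next_action q s, None, s), None).

Local Notation step := (queue_step sweep_delta).

Definition ring (f : nat -> cell) (i n : nat) : seq (option cell) :=
  [seq Some (f j) | j <- iota i n].

(** * One sweep of the queue *)

Section Sweep.
Variables (R : nat) (q : state) (a : act) (prev : option cell).
Variables (s : {ffun index -> sym}) (old : nat -> cell).
Let before i := if i is j.+1 then Some (old j) else prev.
Let after i := if i.+1 < R then Some (old i.+1) else None.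
Let new i := cell_update a (before i) (old i) (after i).
Let collected i := foldl (fun s c => collect c s) s (map new (iota 0 i)).

Lemma partial_sweep i : 0 < R -> i <= R ->
  iter i step ((q, a, prev, s), ring old 0 R ++ [:: None]) =
  ((q, a, before i, collected i), ring old i (R - i) ++ None :: ring new 0 i).
Proof.
move=> R_gt0; elim: i => [|i IHi] lti; first by rewrite subn0.
rewrite iterS IHi ?(ltnW lti) //.
have -> : R - i = (R - i.+1).+1 by lia.
have ec : collected i.+1 = collect (new i) (collected i).
  by rewrite /collected iota_rcons map_rcons -cats1 foldl_cat.
have en : ring new 0 i.+1 = rcons (ring new 0 i) (Some (new i)).
  by rewrite /ring iota_rcons map_rcons add0n.
rewrite ec en {ec en} /queue_step /= -/(ring old i.+1 (R - i.+1)).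
(* Behind the last old cell, the symbol peeked at is the separator. *)
case E : (R - i.+1) => [|n].
  have -> : new i = cell_update a (before i) (old i) None.
    by rewrite /new /after; case: ltnP => //; lia.
  by [].
have -> : new i = cell_update a (before i) (old i) (Some (old i.+1)).
  by rewrite /new /after; case: ltnP => //; lia.
by rewrite /= rcons_cat.
Qed.

(** The step after the [R] cells pops the separator; as [R] is positive a second symbol remains,
    without which [queue_step] does nothing. *)
Lemma sweep : 0 < R -> 
  iter R.+1 step ((q, a, prev, s), ring old 0 R ++ [:: None]) =
  ((next_action q (collected R), None, collected R), ring new 0 R ++ [:: None]).
Proof.
move=> R_gt0; rewrite iterS partial_sweep // subnn /=.
by case: R R_gt0 => // n _; rewrite /queue_step /= cats1.
Qed.

(** Exactly one new cell carries the head of tape [t], so entry [t] is overwritten once, whatever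
    [s] was. *)
Lemma collectedE (h : index -> nat) :
  (forall i t, i < R -> (new i t).2 = (i == h t)) -> (forall t, h t < R) ->
  collected R = [ffun t => (new (h t) t).1].
Proof.
move=> hn hR; apply/ffunP=> t; rewrite ffunE.
suff H i : i <= R -> h t < i -> collected i t = (new (h t) t).1 by apply: H.
elim: i => // i IHi lti; rewrite /collected iota_rcons map_rcons -cats1
  foldl_cat /=.
rewrite add0n ffunE hn // -/(collected i) ltnS leq_eqVlt eq_sym.
by case: eqP => [->//|_ /=]; apply: IHi; apply: ltnW.
Qed.

End Sweep.

(** * Sweeps act on cells as steps act on tapes *)

Definition tape_cell (T : tapes) (i : nat) : cell :=
  [ffun t => (nth blank (tape_cells (T t)) i, i == size (left_part (T t)))].

Definition act_tapes (T : tapes) (a : act) : tapes :=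
  [ffun t => tape_act blank (T t) (a t)].

Lemma nth_tape_act (tp : tape sym) a i :
  nth blank (tape_cells (tape_act blank tp a)) i =
  if i == size (left_part tp) then a.1 else nth blank (tape_cells tp) i.
Proof.
have aux (l r : seq sym) x y : nth blank (rev l ++ x :: r) i =
    if i == size l then x else nth blank (rev l ++ y :: r) i.
  rewrite !nth_cat size_rev; case: ltngtP => // [lt|->]; last by rewrite subnn.
  by have -> : i - size l = (i - size l).-1.+1 by lia.
case: tp a => l s r [b []] /=; last 1 first.
- rewrite (_ : tape_cells _ = rev l ++ b :: (head blank r) :: behead r);
  last first.
    by rewrite /tape_cells /= rev_cons cat_rcons.
  case: r => [|y r] /=; last exact: aux.
  (* Moving right off the listed cells lists one more blank, which [nth blank] does not see. *)
  rewrite /tape_cells /= -(aux _ _ b s).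
  rewrite -[[:: b; blank]]/([:: b] ++ [:: blank]) catA [LHS]nth_cat.
  case: ltnP => // le; rewrite [RHS]nth_default //.
  by case: (i - _) => [|[]].
- case: l => [|x l]; rewrite /tape_cells /=; first exact: (aux [::]).
  by rewrite -cat_rcons -rev_cons; apply: (aux (x :: l)).
- exact: aux.
Qed.

Lemma size_left_tape_act (tp : tape sym) a :
  size (left_part (tape_act blank tp a)) =
  match a.2 with
  | MoveN => size (left_part tp)
  | MoveR => (size (left_part tp)).+1
  | MoveL => (size (left_part tp)).-1
  end.
Proof. by case: tp a => [[|x l] s r] [b []]. Qed.

Lemma cell_update_tapes (T : tapes) a R i :
  (forall t, size (left_part (T t)) < R) -> i < R ->
  cell_update a (if i is j.+1 then Some (tape_cell T j) else None)
    (tape_cell T i) (if i.+1 < R then Some (tape_cell T i.+1) else None) =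
  tape_cell (act_tapes T a) i.
Proof.
move=> hR lti; apply/ffunP=> t;
  rewrite !ffunE nth_tape_act size_left_tape_act /=.
congr (_, _); have := hR t; set l := size _ => ltl.
case: (a t).2 => //=.
(* No head is at position [R], so none is missed when the right neighbour is the separator. *)
- case: ltnP => h; rewrite ?ffunE /= -/l; case: i lti h => [|i] lti h /=; lia.
- by case: i lti => [|i] _; rewrite ?ffunE /=.
Qed.

Lemma eq_ring f g R : (forall i, i < R -> f i = g i) -> ring f 0 R = ring g 0 R.
Proof.
by move=> e; apply/eq_in_map => i; rewrite mem_iota => /andP[_ /e ->].
Qed.

Definition scan (T : tapes) : {ffun index -> sym} := [ffun t => scanned (T t)].

Lemma nth_tape_cells (tp : tape sym) :
  nth blank (tape_cells tp) (size (left_part tp)) = scanned tp.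
Proof. by case: tp => l s r; rewrite nth_cat size_rev ltnn subnn. Qed.

(** The condition on [prev] and [old] is kept abstract to cover both the first sweep, which installs
    the heads, and the later ones. *)
Lemma sweep_tapes (q : state) a prev s old R (T : tapes) :
  0 < R -> (forall t, size (left_part (T t)) < R) ->
  (forall i, i < R -> cell_update a (if i is j.+1 then Some (old j) else prev)
     (old i) (if i.+1 < R then Some (old i.+1) else None) = tape_cell T i) ->
  iter R.+1 step ((q, a, prev, s), ring old 0 R ++ [:: None]) =
  ((next_action q (scan T), None, scan T), ring (tape_cell T) 0 R ++ [:: None]).
Proof.
move=> R_gt0 hT hc; rewrite sweep // (eq_ring hc).
rewrite (@collectedE _ _ _ _ _ (fun t => size (left_part (T t)))) //;
  last first.
  by move=> i t lti; rewrite hc // ffunE.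
suff -> : [ffun t => (cell_update a
    (if size (left_part (T t)) is j.+1 then Some (old j) else prev)
    (old (size (left_part (T t))))
    (if (size (left_part (T t))).+1 < R
     then Some (old (size (left_part (T t))).+1) else None) t).1] = scan T by
       [].
by apply/ffunP=> t; rewrite ffunE hc // !ffunE nth_tape_cells.
Qed.

Section Run.
Variables (w : seq bool) (R : nat).
Hypothesis R_gt0 : 0 < R.
Hypothesis headP : forall n t, size (left_part (cfg_tapes (tm_run M w n) t)) <
  R.

Lemma tm_step_next (c : config M) (x := next_action (cfg_state c) (scan
  (cfg_tapes c))) :
  tm_step c = Config x.1 (act_tapes (cfg_tapes c) x.2).
Proof.
rewrite /x /tm_step /next_action /halted; case: ifP => _ /=.
  case: c {x} => q T /=; congr Config; apply/ffunP=> t; rewrite !ffunE /=.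
  by case: (T t).
by rewrite /scan; case: tm_trans.
Qed.

(* The heads start at a virtual position left of the tapes and the first
   action moves them right, which lets the first sweep scan the tapes. *)
Definition start_control : control :=
  (tm_start M, [ffun=> (blank, MoveR)], Some [ffun=> (blank, true)],
   [ffun=> blank]).

Definition start_cell (i : nat) : cell :=
  [ffun t => (nth blank (tape_cells (cfg_tapes (tm_init M w) t)) i, false)].

Definition start_queue : seq (option cell) := ring start_cell 0 R ++ [:: None].

(** The first sweep only installs the heads, so configuration [n] takes [n.+1] sweeps; the control
    already holds the next state and the pending action. *)
Lemma run_sweeps n :
  let c := tm_run M w n in
  iter (n.+1 * R.+1) step (start_control, start_queue) =
  ((next_action (cfg_state c) (scan (cfg_tapes c)), None, scan (cfg_tapes c)),
   ring (tape_cell (cfg_tapes c)) 0 R ++ [:: None]).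
Proof.
elim: n => [|n IHn] c.
  rewrite mul1n; apply: sweep_tapes => // [t|i lti]; first exact: (headP 0).
  apply/ffunP=> t; rewrite [LHS]ffunE [RHS]ffunE !ffunE /=.
  by congr (_, _); case: i lti => [|i] _; rewrite ?ffunE.
rewrite mulSn iterD IHn.
rewrite /c {c} [tm_run M w n.+1]iterS -/(tm_run M w n) tm_step_next.
set c := tm_run M w n; case E : (next_action _ _) => [q a] /=.
have e : tm_run M w n.+1 = Config q (act_tapes (cfg_tapes c) a).
  by rewrite [LHS]iterS -/(tm_run M w n) tm_step_next -/c E.
apply: sweep_tapes => // [t|i lti]; first by have := headP n.+1 t; rewrite e.
by rewrite cell_update_tapes // => t; apply: headP.
Qed.

(** The state component changes only when the separator is popped, once every [R.+1] steps. *)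
Lemma simulation n :
  (iter n step (start_control, start_queue)).1.1.1.1 =
  cfg_state (tm_run M w (n %/ R.+1)).
Proof.
rewrite {1}(divn_eq n R.+1) addnC iterD.
have : n %% R.+1 <= R by rewrite -ltnS ltn_mod.
case: (n %/ R.+1) => [|m] le.
  by rewrite mul0n /= /start_queue partial_sweep.
rewrite run_sweeps; set c := tm_run M w m.
have -> : tm_run M w m.+1 = tm_step c by rewrite [LHS]iterS.
rewrite tm_step_next; case: (next_action _ _) => q a /=.
by rewrite partial_sweep.
Qed.

End Run.

End Simulation.

(** * The reduction *)

(** In unary a constant offset is a constant prefix, so it can be moved into the fixed word. *)
Lemma stairs_shift (Z : seq bool) m n :
  flatten [seq Z ++ enc_unary i | i <- iota m n] = stairs (Z ++ nseq m true) n.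
Proof.
rewrite /stairs -{1}(addn0 m) iotaDl -map_comp; congr flatten.
by apply: eq_map => i /=; rewrite /enc_unary nseqD -!catA.
Qed.

Section Queue.
Variables (M : TM) (w : seq bool).

Definition bit_cell (b : bool) : cell M :=
  [ffun t => (if t == ord0 then tm_bit M b else tm_blank M, false)].

Definition blank_cell : cell M := [ffun=> (tm_blank M, false)].

Lemma start_queueE k :
  start_queue M w (size w + k).+1 =
  map (Some \o bit_cell) w ++ nseq k (Some blank_cell) ++
  [:: Some blank_cell; None].
Proof.
have load s i : nth (tm_blank M) (tape_cells (load_tape (tm_blank M) s)) i =
                nth (tm_blank M) s i.
  by case: s i => [|x s] [|[]].
rewrite /start_queue -[[:: Some _; None]]cat1s !catA; congr (_ ++ _).
rewrite -catA -[[:: Some _]]/(nseq 1 (Some blank_cell)) -nseqD addn1.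
apply: (@eq_from_nth _ None).
  by rewrite size_cat !size_map size_iota size_nseq addnS.
move=> i; rewrite size_map size_iota => lti.
rewrite (nth_map 0) ?size_iota // nth_iota // add0n nth_cat size_map nth_nseq.
case: ltnP => [ltw|gew].
  rewrite (nth_map false) //=; congr Some; apply/ffunP=> t; rewrite !ffunE load.
  by case: eqP => _; rewrite ?nth_nil // (nth_map false).
rewrite ltn_subLR // addnS lti; congr Some; apply/ffunP=> t;
  rewrite !ffunE load.
by rewrite nth_default //; case: eqP => // _; rewrite size_map.
Qed.

End Queue.

(** Being zero is a condition on all times, so membership is expressed as never rejecting; this is
    sound because a decider halts and halting states persist. *)
Lemma reject_run (M : TM) (L : language) w :
  decides M L -> (L w <-> forall n, cfg_state (tm_run M w n) != tm_reject M).
Proof.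
move=> /(_ w)[t [ht <-]].
have stays n : tm_run M w (n + t) = tm_run M w t.
  elim: n => // n IHn; rewrite addSn [LHS]iterS -/(tm_run M w (n + t)) IHn.
  by rewrite /tm_step ht.
split=> [/eqP acc n|/(_ t)]; last by case/orP: ht => ->.
have nar := tm_accept_reject M.
(* Whichever halting configuration comes first persists, so acceptance at [t] and rejection at [n]
   are incompatible. *)
have [le|/ltnW le] := leqP t n.
  by rewrite -(subnK le) stays acc.
apply/eqP=> rej; move: nar; rewrite -acc -rej.
have stays' m : tm_run M w (m + n) = tm_run M w n.
  elim: m => // m IHm; rewrite addSn [LHS]iterS -/(tm_run M w (m + n)) IHm.
  by rewrite /tm_step /halted rej eqxx orbT.
by rewrite -(subnK le) stays' eqxx.
Qed.

Theorem theorem3 : PSPACE_hard zeroness_problem.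
Proof.
move=> L [M [s [[c [d hs]] [decM spM]]]].
have [G [C [fo [qo [zo hI]]]]] :=
  queue_polyrec (@sweep_delta M) (fun x => x.1.1.1 == tm_reject M).
(* The leading [true] is the continuation bit of [enc_seq]. *)
pose ec (q : rat) := true :: enc_rat q.
pose Bk := ec (code (Some (blank_cell M))).
pose A0 := ec 0%R ++ ec (code (start_control M)).
pose A1 := Bk ++ ec (code (None : option (cell M))) ++ [:: false] ++
  flatten [seq [:: true; false; false] ++ enc_unary i | i <- iota 0 4] ++
  flatten [seq true :: enc_gate g | g <- C].
pose A2 := [:: false] ++ flatten [seq true :: enc_unary i | i <- [:: fo; qo;
  3]].
pose A3 := (true :: enc_unary zo) ++ [:: false].
(* Continuation bit, tag of [Input], and the offset 4 of the second block of inputs; [Y] likewise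
   carries the offset [G] of their gate numbers. *)
pose X := [:: true; false; false] ++ nseq 4 true.
pose Y := [:: true] ++ nseq G true.
(* With [b > 2 * c] one more factor [n + b] absorbs the constants: [c * n ^ d + c <= 2 * c * (n + b)
   ^ d <= (n + b) ^ d.+1]. *)
pose b := (c + c).+1.
exists (template d.+1 b A0 A1 A2 A3 X Y Bk
          (fun b => ec (code (Some (bit_cell M b))))).
split; first exact: poly_time_template.
move=> w; set k := (size w + b) ^ d.+1.
have spaceP n : cfg_space (tm_run M w n) <= k.
  apply: leq_trans (spM w n) _; apply: leq_trans (hs _) _.
  rewrite /k expnS; set x := (size w + b) ^ d.
  have x_gt0 : 0 < x by rewrite /x expn_gt0 /b addnS.
  have lex : size w ^ d <= x by apply: leq_expn; apply: leq_addr.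
  apply: (@leq_trans ((c + c) * x)); last by rewrite leq_mul // /b; lia.
  by rewrite mulnDl leq_add ?leq_mul // leq_pmulr.
have headP n t :
    size (left_part (cfg_tapes (tm_run M w n) t)) < (size w + k).+1.
  rewrite ltnS (leq_trans _ (leq_addl _ _)) // (leq_trans _ (spaceP n)) //.
  rewrite /cfg_space (bigD1 t) //= (leq_trans _ (leq_addr _ _)) //.
  exact: leq_addr.
have sz : size (start_queue M w (size w + k).+1) = (size w + k).+2.
  by rewrite size_cat size_map size_iota addn1.
have [I [uS u0 encI]] := hI (start_control M) _ _ sz.
have -> : template d.+1 b A0 A1 A2 A3 X Y Bk
    (fun b => ec (code (Some (bit_cell M b)))) w = enc_input I.
  rewrite encI /template -/k start_queueE (stairs_shift _ 4) /enc_seq.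
  rewrite -cat1s -(cat1s (code _)) !map_cat !flatten_cat.
  rewrite (stairs_shift [:: true] G) -!map_comp map_nseq.
  rewrite /A0 /A1 /A2 /A3 /Bk /ec; set i4 := flatten (map _ (iota 0 4)).
  rewrite -/X -/Y; set sX := stairs X _; set sY := stairs Y _.
  set gC := flatten (map _ C); set rk := flatten (nseq k _).
  rewrite [[seq true :: enc_unary i | i <- [:: zo]]]/=.
  by rewrite /= !cats0 -!catA /= -!catA /= -!catA.
rewrite zeroness_problem_enc (reject_run w decM).
have sim := simulation (isT : 0 < (size w + k).+1) headP.
split=> [nrej [|n]|zero n]; first exact: u0.
  by rewrite uS sim (negbTE (nrej _)).
apply/eqP=> rej.
(* State [n] of [M] shows after [n] sweeps of [size w + k + 2] steps each, and in the sequence one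
   term later. *)
have := zero (n * (size w + k).+2).+1.
by rewrite uS sim mulnK // rej eqxx.
Qed.
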